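(* Let $M$ be a smooth toric variety of complex dimension $n\ge 1$ endowed with a Kähler structure such that the $\mathbb{T}^n$-action is Hamiltonian. Consider the volume functional $\mathrm{Vol}$ restricted to the set of non-degenerate $\mathbb{T}^n$-orbits, regarded as a function $\mathrm{Vol}:\mathbb{R}^n\to(0,\infty)$ of the logarithmic variable $x$ described in the context. Then: (1) $\mathrm{Ric}<0$ on the open $(\mathbb{C}^* )^n$-orbit if and only if $\log\mathrm{Vol}$ is strictly convex. In this case $\mathrm{Vol}$ is strictly convex, and $M$ is not compact. (2) $\mathrm{Ric}>0$ on the open $(\mathbb{C}^* )^n$-orbit if and only if $-\log\mathrm{Vol}$ is strictly convex. In this case $1/\mathrm{Vol}$ is strictly convex; if moreover $M$ is compact, then $\mathrm{Vol}$ has a unique critical point, which corresponds to a global maximum, and the corresponding $\mathbb{T}^n$-orbit is a minimal Lagrangian $n$-torus in $M$.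
   Context: A (smooth) toric variety is a complex manifold $M$ endowed with an effective holomorphic action of the complex Lie group $(\mathbb{C}^* )^n$ admitting a dense open orbit. The action on this open orbit is free, so $\dim_{\mathbb{C}}M=n$ and the choice of a base point identifies the open orbit with $(\mathbb{C}^* )^n$. The real torus $\mathbb{T}^n\subset(\mathbb{C}^* )^n$ acts by restriction. Let $\omega$ be the Kähler form. The $\mathbb{T}^n$-action is Hamiltonian if there is a moment map, i.e. a $\mathbb{T}^n$-invariant smooth map $\mu:M\to(\mathrm{Lie}(\mathbb{T}^n))^*$ with $d(\mu\cdot X)=\omega(\tilde X,\cdot)$ for all $X\in\mathrm{Lie}(\mathbb{T}^n)$, where $\tilde X$ is the fundamental vector field of $X$. The non-degenerate (i.e. $n$-dimensional) $\mathbb{T}^n$-orbits are those contained in the open orbit. Via the biholomorphism $\mathbb{C}^n/2\pi i\,\mathbb{Z}^n\to(\mathbb{C}^* )^n$, $x+iy\mapsto(e^{x_1+iy_1},\dots,e^{x_n+iy_n})$, they are exactly the tori $L_x=\{x\}\times(\mathbb{R}^n/2\pi\mathbb{Z}^n)$, $x\in\mathbb{R}^n$. $\mathrm{Vol}(x)$ denotes the Riemannian $n$-dimensional volume of $L_x$ with respect to the metric induced by the Kähler metric. Convexity always refers to the variable $x=(\log r_1,\dots,\log r_n)\in\mathbb{R}^n$; changing the base point only translates $x$. ''Strictly convex'' means that the Hessian with respect to $x$ is positive definite at every point. $\mathrm{Ric}$ is the Ricci curvature of the Kähler metric; $\mathrm{Ric}<0$ (resp. $>0$) means negative (resp. positive)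 definite. A submanifold is minimal if it is a critical point of the Riemannian volume functional (zero mean curvature), and Lagrangian if it has real dimension $n$ and $\omega$ vanishes on its tangent spaces. *)

(* Defs.v *)
From HB Require Import structures.
From mathcomp Require Import all_boot all_order all_algebra.
From mathcomp Require Import all_classical all_reals all_analysis.
From mathcomp Require Import complex.

Set Implicit Arguments.
Unset Strict Implicit.
Unset Printing Implicit Defensive.

Import Order.TTheory GRing.Theory Num.Theory.
Import numFieldNormedType.Exports.

Local Open Scope classical_set_scope.
Local Open Scope ring_scope.
Local Open Scope complex_scope.

(* Vectors are row vectors and matrices act on the right: a bilinear form with
   Gram matrix A is (u, v) |-> u *m A *m v^T, and 'J f z is the matrix such
   that 'd f z u = u *m 'J f z. *)

Definition posdef (R : realType) (k : nat) (A : 'M[R]_k) : Prop :=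
  forall v : 'rV[R]_k, v != 0 -> 0 < (v *m A *m v^T) 0 0.

Definition negdef (R : realType) (k : nat) (A : 'M[R]_k) : Prop :=
  posdef (- A).

Definition basis_vec (R : realType) (k : nat) (j : 'I_k) : 'rV[R]_k :=
  delta_mx 0 j.

Definition pderiv (R : realType) (k : nat) (j : 'I_k) (f : 'rV[R]_k -> R)
    (z : 'rV[R]_k) : R :=
  'D_(basis_vec R j) f z.

(* For open U in a finite-dimensional space this is C^oo: every iterated
   directional derivative of f is differentiable at the points of U. *)
Definition smooth_on (R : realType) (V W : normedModType R) (U : set V)
    (f : V -> W) : Prop :=
  forall (s : seq V) (z : V), U z ->
    differentiable (foldr (fun (v : V) (h : V -> W) => fun a : V => 'D_v h a) f s) z.

Definition hessian (R : realType) (k : nat) (f : 'rV[R]_k -> R)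
    (x : 'rV[R]_k) : 'M[R]_k :=
  \matrix_(i, j) pderiv i (pderiv j f) x.

Definition strictly_convex (R : realType) (k : nat) (f : 'rV[R]_k -> R) : Prop :=
  smooth_on [set: 'rV[R]_k] f /\ forall x, posdef (hessian f x).

Definition critical_point (R : realType) (k : nat) (f : 'rV[R]_k -> R)
    (x : 'rV[R]_k) : Prop :=
  forall v : 'rV[R]_k, is_derive x v f 0.

(* Iterated Lebesgue integral over the cube [0, 2 pi]^k; it is only applied to
   continuous integrands. *)
Fixpoint cube_integral (R : realType) (k : nat) : ('rV[R]_k -> R) -> R :=
  match k with
  | 0%N => fun f => f 0
  | k'.+1 => fun f =>
      (\int[lebesgue_measure]_(t in `[0%R, (2 * pi)%R])
         cube_integral (fun y : 'rV[R]_k' =>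
           f (row_mx (t%:M : 'M[R]_1) y : 'rV[R]_k'.+1)))%R
  end.

(* l is the upper index. *)
Definition christoffel (R : realType) (k : nat) (G : 'rV[R]_k -> 'M[R]_k)
    (l i j : 'I_k) (z : 'rV[R]_k) : R :=
  2^-1 * \sum_m invmx (G z) l m *
    (pderiv i (fun a => G a m j) z + pderiv j (fun a => G a m i) z
     - pderiv m (fun a => G a i j) z).

(* Ricci tensor of the Levi-Civita connection, with the sign for which round
   spheres have positive Ricci curvature. *)
Definition ricci (R : realType) (k : nat) (G : 'rV[R]_k -> 'M[R]_k)
    (z : 'rV[R]_k) : 'M[R]_k :=
  \matrix_(i, j)
    (\sum_l (pderiv l (christoffel G l i j) z - pderiv j (christoffel G l i l) z)
     + \sum_l \sum_m (christoffel G l l m z * christoffel G m i j z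
                      - christoffel G l j m z * christoffel G m i l z)).

(* Mean curvature vector of an immersion f : R^d -> (R^k, G): the part of
   sum_(a, b) h^(ab) nabla_(d_a f) d_b f normal to f, where h is the induced
   metric. *)
Definition mean_curvature (R : realType) (d k : nat) (G : 'rV[R]_k -> 'M[R]_k)
    (f : 'rV[R]_d -> 'rV[R]_k) (y : 'rV[R]_d) : 'rV[R]_k :=
  let T : 'M[R]_(d, k) := jacobian f y in
  let h : 'M[R]_d := T *m G (f y) *m T^T in
  let nabla (a b : 'I_d) : 'rV[R]_k :=
    \row_l (pderiv a (pderiv b (fun u => f u 0 l)) y
            + \sum_i \sum_j christoffel G l i j (f y) * T a i * T b j) in
  let w : 'rV[R]_k := \sum_a \sum_b invmx h a b *: nabla a b in
  w - w *m G (f y) *m T^T *m invmx h *m T.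

(* C^n is 'rV[R]_(n + n): real parts first, then imaginary parts.  Jcx is
   multiplication by i, (a, b) |-> (- b, a). *)
Definition Jcx (R : realType) (n : nat) : 'M[R]_(n + n) :=
  block_mx 0 1%:M (- 1%:M) 0.

Definition cplx (R : realType) (n : nat) (v : 'rV[R]_(n + n)) : 'I_n -> R[i] :=
  fun j => v 0 (lshift n j) +i* v 0 (rshift n j).

(* Holomorphic maps as smooth maps with complex-linear differential, JV and JW
   being the complex structures of source and target. *)
Definition holomorphic_on (R : realType) (V W : normedModType R)
    (JV : V -> V) (JW : W -> W) (U : set V) (f : V -> W) : Prop :=
  smooth_on U f /\
  forall z : V, U z -> forall v : V, 'd f z (JV v) = JW ('d f z v).

Definition mulJ (R : realType) (n : nat) (v : 'rV[R]_(n + n)) : 'rV[R]_(n + n) :=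
  v *m Jcx R n.

Definition mulJ2 (R : realType) (n : nat)
    (v : 'rV[R]_(n + n) * 'rV[R]_(n + n)) : 'rV[R]_(n + n) * 'rV[R]_(n + n) :=
  (mulJ v.1, mulJ v.2).

(* A structure of complex manifold of dimension n on the space M.  chart_at
   selects a chart around each point. *)
Record complexManifold (R : realType) (n : nat) (M : topologicalType) :=
  ComplexManifold {
  chart_index : Type;
  chart_dom : chart_index -> set M;
  chart_map : chart_index -> M -> 'rV[R]_(n + n);
  chart_inv : chart_index -> 'rV[R]_(n + n) -> M;
  chart_at : M -> chart_index;
  cm_hausdorff : hausdorff_space M;
  cm_second_countable : @second_countable M;
  chart_dom_open : forall i, open (chart_dom i);
  chart_img_open : forall i, open (chart_map i @` chart_dom i);
  chart_mapK : forall i p, chart_dom i p -> chart_inv i (chart_map i p) = p;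
  chart_map_continuous : forall i p, chart_dom i p ->
    {for p, continuous (chart_map i)};
  chart_inv_continuous : forall i z, (chart_map i @` chart_dom i) z ->
    {for z, continuous (chart_inv i)};
  chart_atP : forall p, chart_dom (chart_at p) p;
  chart_transition : forall i j,
    holomorphic_on (@mulJ R n) (@mulJ R n)
      (chart_map i @` (chart_dom i `&` chart_dom j))
      (fun z => chart_map j (chart_inv i z))
}.

Definition chart_img (R : realType) (n : nat) (M : topologicalType)
    (X : complexManifold R n M) (i : chart_index X) : set 'rV[R]_(n + n) :=
  @chart_map R n M X i @` @chart_dom R n M X i.

(* Membership in the complex torus of all t with nonzero components, whose
   group law is componentwise multiplication. *)
Definition in_torus (R : realType) (n : nat) (t : 'I_n -> R[i]) : Prop :=
  forall j, t j != 0.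

Definition orbit_of (R : realType) (n : nat) (M : topologicalType)
    (act : ('I_n -> R[i]) -> M -> M) (p : M) : set M :=
  [set act t p | t in [set t | in_torus t]].

(* Joint holomorphy is expressed in charts; the source set there is open by
   tact_continuous.  Nothing is required of tact t outside in_torus. *)
Record toricAction (R : realType) (n : nat) (M : topologicalType)
    (X : complexManifold R n M) := ToricAction {
  tact : ('I_n -> R[i]) -> M -> M;
  tact1 : forall p, tact (fun=> 1) p = p;
  tactM : forall s t p, in_torus s -> in_torus t ->
    tact (fun j => s j * t j) p = tact s (tact t p);
  tact_continuous :
    {within [set tp : 'rV[R]_(n + n) * M | in_torus (cplx tp.1)],
      continuous (fun tp : 'rV[R]_(n + n) * M => tact (cplx tp.1) tp.2)};
  tact_holomorphic : forall i j : chart_index X,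
    holomorphic_on (@mulJ2 R n) (@mulJ R n)
      [set tz : 'rV[R]_(n + n) * 'rV[R]_(n + n) |
         [/\ in_torus (cplx tz.1), chart_img i tz.2
           & chart_dom j (tact (cplx tz.1) (chart_inv i tz.2))]]
      (fun tz => chart_map j (tact (cplx tz.1) (chart_inv i tz.2)));
  tact_effective : forall t, in_torus t ->
    (forall p, tact t p = p) -> t = (fun=> 1);
  tact_dense_open : exists p, open (orbit_of tact p) /\ dense (orbit_of tact p)
}.

Definition in_open_orbit (R : realType) (n : nat) (M : topologicalType)
    (X : complexManifold R n M) (A : toricAction X) (p : M) : Prop :=
  open (orbit_of (tact A) p) /\ dense (orbit_of (tact A) p).

(* omega (u, v) = g (J u, v) *)
Definition form_of (R : realType) (n : nat) (G : 'M[R]_(n + n)) : 'M[R]_(n + n) :=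
  Jcx R n *m G.

(* metric i z is the Gram matrix of the Riemannian metric in the real
   coordinates of the chart i. *)
Record kahlerMetric (R : realType) (n : nat) (M : topologicalType)
    (X : complexManifold R n M) := KahlerMetric {
  metric : chart_index X -> 'rV[R]_(n + n) -> 'M[R]_(n + n);
  metric_smooth : forall i, smooth_on (chart_img i) (metric i);
  metric_change : forall (i j : chart_index X) (z : 'rV[R]_(n + n)),
    (chart_map i @` (chart_dom i `&` chart_dom j)) z ->
    let tau := fun a : 'rV[R]_(n + n) => chart_map j (chart_inv i a) in
    metric i z = jacobian tau z *m metric j (tau z) *m (jacobian tau z)^T;
  metric_sym : forall i z, chart_img i z -> (metric i z)^T = metric i z;
  metric_posdef : forall i z, chart_img i z -> posdef (metric i z);
  metric_hermitian : forall i z, chart_img i z ->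
    Jcx R n *m metric i z *m (Jcx R n)^T = metric i z;
  kahler_closed : forall (i : chart_index X) (z : 'rV[R]_(n + n)),
    chart_img i z -> forall a b c : 'I_(n + n),
    pderiv a (fun u => form_of (metric i u) b c) z
    + pderiv b (fun u => form_of (metric i u) c a) z
    + pderiv c (fun u => form_of (metric i u) a b) z = 0
}.

Definition kahler_form (R : realType) (n : nat) (M : topologicalType)
    (X : complexManifold R n M) (g : kahlerMetric X) (i : chart_index X)
    (z : 'rV[R]_(n + n)) : 'M[R]_(n + n) :=
  form_of (metric g i z).

(* Gram matrix at v of the pull-back along F : R^m -> M of a covariant
   2-tensor B given in charts. *)
Definition pullback (R : realType) (n : nat) (M : topologicalType)
    (X : complexManifold R n M)
    (B : chart_index X -> 'rV[R]_(n + n) -> 'M[R]_(n + n))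
    (m : nat) (F : 'rV[R]_m -> M) (v : 'rV[R]_m) : 'M[R]_m :=
  let i := chart_at X (F v) in
  let D : 'M[R]_(m, n + n) := jacobian (fun a => chart_map i (F a)) v in
  D *m B i (chart_map i (F v)) *m D^T.

Definition cexp (R : realType) (a b : R) : R[i] :=
  (expR a * cos b) +i* (expR a * sin b).

(* The Lie algebra of the real torus is R^n, with exponential
   xi |-> (e^(sqrt(-1) xi_j))_j.  fundamental_field A xi i is the fundamental
   vector field of xi read in the chart i. *)
Definition fundamental_field (R : realType) (n : nat) (M : topologicalType)
    (X : complexManifold R n M) (A : toricAction X) (xi : 'rV[R]_n)
    (i : chart_index X) (z : 'rV[R]_(n + n)) : 'rV[R]_(n + n) :=
  'D_1 (fun s : R =>
    chart_map i (tact A (fun j => cexp 0 (s * xi 0 j)) (chart_inv i z))) 0.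

Definition moment_map (R : realType) (n : nat) (M : topologicalType)
    (X : complexManifold R n M) (A : toricAction X) (g : kahlerMetric X)
    (mu : M -> 'rV[R]_n) : Prop :=
  [/\ forall i : chart_index X,
        smooth_on (chart_img i) (fun z => mu (chart_inv i z)),
      forall t, (forall j, `|t j| = 1) -> forall p, mu (tact A t p) = mu p
    & forall (xi : 'rV[R]_n) (i : chart_index X) (z : 'rV[R]_(n + n)),
        chart_img i z -> forall v : 'rV[R]_(n + n),
        'D_v (fun a => (mu (chart_inv i a) *m xi^T) 0 0) z
        = (fundamental_field A xi i z *m kahler_form g i z *m v^T) 0 0].

Definition hamiltonian (R : realType) (n : nat) (M : topologicalType)
    (X : complexManifold R n M) (A : toricAction X) (g : kahlerMetric X) : Prop :=
  exists mu : M -> 'rV[R]_n, moment_map A g mu.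

(* Logarithmic parametrization x + i y |-> (e^(x_j + i y_j))_j . p0 of the
   orbit of p0.  On the open orbit its local inverses are holomorphic charts, so
   log_metric below is the metric in these coordinates. *)
Definition log_param (R : realType) (n : nat) (M : topologicalType)
    (X : complexManifold R n M) (A : toricAction X) (p0 : M)
    (v : 'rV[R]_(n + n)) : M :=
  tact A (fun j => cexp (v 0 (lshift n j)) (v 0 (rshift n j))) p0.

Definition log_metric (R : realType) (n : nat) (M : topologicalType)
    (X : complexManifold R n M) (A : toricAction X) (g : kahlerMetric X)
    (p0 : M) : 'rV[R]_(n + n) -> 'M[R]_(n + n) :=
  pullback (metric g) (log_param A p0).

Definition ricci_neg_on_orbit (R : realType) (n : nat) (M : topologicalType)
    (X : complexManifold R n M) (A : toricAction X) (g : kahlerMetric X)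
    (p0 : M) : Prop :=
  forall v, negdef (ricci (log_metric A g p0) v).

Definition ricci_pos_on_orbit (R : realType) (n : nat) (M : topologicalType)
    (X : complexManifold R n M) (A : toricAction X) (g : kahlerMetric X)
    (p0 : M) : Prop :=
  forall v, posdef (ricci (log_metric A g p0) v).

(* y |-> orbit_param A p0 x y parametrizes the real torus orbit L_x. *)
Definition orbit_param (R : realType) (n : nat) (M : topologicalType)
    (X : complexManifold R n M) (A : toricAction X) (p0 : M)
    (x y : 'rV[R]_n) : M :=
  log_param A p0 (row_mx x y).

Definition Vol (R : realType) (n : nat) (M : topologicalType)
    (X : complexManifold R n M) (A : toricAction X) (g : kahlerMetric X)
    (p0 : M) (x : 'rV[R]_n) : R :=
  cube_integral (fun y : 'rV[R]_n =>
    Num.sqrt (\det (pullback (metric g) (orbit_param A p0 x) y))).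

(* F induces an injective immersion of R^n / (2 pi Z)^n. *)
Definition is_torus_param (R : realType) (n : nat) (M : topologicalType)
    (X : complexManifold R n M) (F : 'rV[R]_n -> M) : Prop :=
  (forall y y' : 'rV[R]_n, F y = F y' <->
     exists k : 'I_n -> int, y' - y = \row_j (2 * pi * (k j)%:~R)) /\
  (forall y : 'rV[R]_n,
     row_free (jacobian (fun a => chart_map (chart_at X (F y)) (F a)) y)).

Definition is_lagrangian_param (R : realType) (n : nat) (M : topologicalType)
    (X : complexManifold R n M) (g : kahlerMetric X) (F : 'rV[R]_n -> M) : Prop :=
  forall y : 'rV[R]_n, pullback (kahler_form g) F y = 0.

Definition is_minimal_orbit (R : realType) (n : nat) (M : topologicalType)
    (X : complexManifold R n M) (A : toricAction X) (g : kahlerMetric X)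
    (p0 : M) (x : 'rV[R]_n) : Prop :=
  forall y : 'rV[R]_n,
    mean_curvature (log_metric A g p0) (fun u : 'rV[R]_n => row_mx x u) y = 0.

(* Main.v *)
Require Import Defs.
From HB Require Import structures.
From mathcomp Require Import all_boot all_order all_algebra.
From mathcomp Require Import all_classical all_reals all_analysis.
From mathcomp Require Import complex.
From mathcomp Require Import ring lra.

Import Order.TTheory GRing.Theory Num.Theory.
Import numFieldNormedType.Exports.

Local Open Scope classical_set_scope.
Local Open Scope ring_scope.
Set Implicit Arguments.
Unset Strict Implicit.
Unset Printing Implicit Defensive.

(** In the logarithmic coordinate x + iy of the open orbit, everything is
    governed by one field P of symmetric matrices on R^n.

    The moment map is invariant under the real torus, so on the open orbit it is
    a function of x alone. The fundamental fields are the coordinate fields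
    d/dy_j, and d/dx_j is - i times d/dy_j. The moment map identity thus says
    that the torus orbits are isotropic and that minus the Jacobian matrix of the
    moment map in x is the Gram matrix P of the fundamental fields
    ([gram_fieldE]). As the metric is Hermitian, it equals diag (P, P) with P
    depending on x only ([log_metricE]). P is a Hessian metric:
    d_k P_ij is totally symmetric because second derivatives of the moment map
    commute ([gram_field_hessian_metric]). It is definite because points of the
    open orbit have trivial stabilizers: the action is effective and the orbit
    is dense ([gram_field_posdef]).

    For such a metric the Ricci tensor is diag (- H, - H), with H the Hessian of
    1/2 log det P ([ricci_tube]). The orbit over x is a flat torus of volume
    Vol x = (2 pi)^n sqrt (det (P x)) ([VolE]). Hence H is the Hessian of
    log Vol, which gives both equivalences. The exponential of a strictly
    convex function is strictly convex, which gives the statements on Vol and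
    1/Vol. The mean curvature vector of the orbit over x is minus the gradient of
    log Vol ([mean_curvature_tube]), so critical points give minimal tori.

    If M is compact, Vol tends to 0 at infinity ([vol_decay]), so it attains
    a maximum. This excludes strict convexity of Vol, and when - log Vol is
    strictly convex the maximum is the only critical point. To prove the decay,
    let p be a point of M. If the fundamental fields are dependent at p, then Vol
    is small on the orbits near p. Otherwise their Gram matrices are bounded below
    near p. Minus the moment map is a strictly monotone function of x, so it
    separates distant points by a definite amount, whereas its values near p are
    close to each other; hence the x whose orbit comes near p form a bounded
    set. *)


(** * Smooth functions of finite order *)

Section Ck.
Context {R : realType}.

(** Smoothness of finite order: all iterated directional derivatives of f up
    to order k are differentiable on U. The recursion on k is what closure
    under products and composition is proved by. *)
Fixpoint Ck (V W : normedModType R) (k : nat) (U : set V) (f : V -> W) : Prop :=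
  (forall z, U z -> differentiable f z) /\
  match k with
  | 0%N => True
  | k'.+1 => forall v, Ck k' U (fun z => 'D_v f z)
  end.

Lemma Ck_diff (V W : normedModType R) k (U : set V) (f : V -> W) z :
  Ck k U f -> U z -> differentiable f z.
Proof. by case: k => [|k] [+ _]; exact. Qed.

Lemma Ck_derive (V W : normedModType R) k (U : set V) (f : V -> W) v :
  Ck k.+1 U f -> Ck k U (fun z => 'D_v f z).
Proof. by case=> _; exact. Qed.

Lemma smooth_onP (V W : normedModType R) (U : set V) (f : V -> W) :
  smooth_on U f <-> forall k, Ck k U f.
Proof.
split=> [fs k|fC s].
  elim: k f fs => [|k IH] f fs; split; try by move=> z; exact: (fs [::]).
    by [].
  move=> v; apply: IH => s z Uz.
  by have := fs (rcons s v) z Uz; rewrite foldr_rcons.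
elim/last_ind: s f fC => [|s v IH] f fC z Uz.
  exact: Ck_diff (fC 0%N) Uz.
rewrite foldr_rcons; apply: IH => // k.
by have [_] := fC k.+1; exact.
Qed.

Lemma smooth_onD (V W : normedModType R) (U : set V) (f : V -> W) v :
  smooth_on U f -> smooth_on U (fun z => 'D_v f z).
Proof. by move=> fs s z Uz; have := fs (rcons s v) z Uz; rewrite foldr_rcons. Qed.

Lemma CkW (V W : normedModType R) k (U : set V) (f : V -> W) :
  Ck k.+1 U f -> Ck k U f.
Proof.
elim: k f => [|k IH] f [fd fC]; split=> // v.
exact/IH/fC.
Qed.

Lemma Ck_sub (V W : normedModType R) k (U U' : set V) (f : V -> W) :
  U' `<=` U -> Ck k U f -> Ck k U' f.
Proof.
move=> sU; elim: k f => [|k IH] f [fd fC]; split=> //;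
  try by move=> z /sU; exact: fd.
by move=> v; exact/IH/fC.
Qed.

Lemma near_eq_differentiable (V W : normedModType R) (f g : V -> W) z :
  (\near z, f z = g z) -> differentiable f z -> differentiable g z.
Proof.
move=> fg df.
have fgz := nbhs_singleton fg.
have cd : continuous ('d f z) by exact: diff_continuous.
have gE : g \o shift z = cst (g z) + 'd f z +o_ (0 : V) id.
  apply/eqaddoP => _/posnumP[e].
  have /diff_locally /eqaddoP /(_ e%:num [gt0 of e%:num]) := df.
  apply: filter_app.
  have := fg; rewrite (near_shift 0 z) subr0 => fg0.
  near=> h.
  suff -> : (g \o shift z - (cst (g z) + 'd f z)) h =
            (f \o shift z - (cst (f z) + 'd f z)) h by [].
  by rewrite !fctE -fgz; have /= -> // := near fg0 h _.
have dE : 'd g z = 'd f z :> (V -> W) by exact: diff_unique.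
apply/diff_locallyP; rewrite dE; split=> //.
Unshelve. all: by end_near. Qed.

Lemma Ck_eq (V W : normedModType R) k (U : set V) (f g : V -> W) :
  open U -> (forall z, U z -> f z = g z) -> Ck k U f -> Ck k U g.
Proof.
move=> oU; elim: k f g => [|k IH] f g fg [fd fC]; split=> //;
  try by move=> z Uz; apply: near_eq_differentiable (fd _ Uz); near=> y; apply: fg;
      near: y; exact: open_nbhs_nbhs.
move=> v; apply: IH (fC v) => z Uz; apply: near_eq_derive; near=> y; apply: fg.
by near: y; exact: open_nbhs_nbhs.
Unshelve. all: by end_near. Qed.

Lemma smooth_eq (V W : normedModType R) (U : set V) (f g : V -> W) :
  open U -> (forall z, U z -> f z = g z) -> smooth_on U f -> smooth_on U g.
Proof. by move=> oU fg /smooth_onP fC; apply/smooth_onP => k; exact: Ck_eq (fC k). Qed.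

Lemma Ck_cst (V W : normedModType R) k (U : set V) (c : W) : Ck k U (fun=> c).
Proof.
elim: k c => [|k IH] c; split=> //.
move=> v; rewrite [X in Ck _ _ X](_ : _ = (fun=> 0)); first exact: IH.
by apply/funext => z; rewrite -/(cst c) derive_cst.
Qed.

Lemma CkD (V W : normedModType R) k (U : set V) (f g : V -> W) :
  open U -> Ck k U f -> Ck k U g -> Ck k U (fun z => f z + g z).
Proof.
move=> oU; elim: k f g => [|k IH] f g fC gC.
  by split=> // z Uz; apply: differentiableD; [exact: Ck_diff fC Uz|exact: Ck_diff gC Uz].
split=> [z Uz|v].
  by apply: differentiableD; [exact: Ck_diff fC Uz|exact: Ck_diff gC Uz].
have fCv := fC.2 v; have gCv := gC.2 v.
apply: (Ck_eq oU _ (IH _ _ fCv gCv)) => z Uz.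
by rewrite /= deriveD //; apply: diff_derivable; [exact: Ck_diff fC Uz|exact: Ck_diff gC Uz].
Qed.

Lemma Ck_sum (V W : normedModType R) k (U : set V) (I : Type) (s : seq I) (P : pred I)
  (f : I -> V -> W) :
  open U -> (forall i, P i -> Ck k U (f i)) -> Ck k U (fun z => \sum_(i <- s | P i) f i z).
Proof.
move=> oU fC; elim: s => [|i s IH].
  by apply: (Ck_eq oU _ (Ck_cst k U (0 : W))) => z _; rewrite big_nil.
case: (boolP (P i)) => Pi; last first.
  by apply: (Ck_eq oU _ IH) => z _; rewrite big_cons (negbTE Pi).
by apply: (Ck_eq oU _ (CkD oU (fC i Pi) IH)) => z _; rewrite big_cons Pi.
Qed.

Lemma Ck_lin (V W X : normedModType R) k (U : set V) (L : {linear W -> X}) (f : V -> W) :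
  open U -> continuous L -> Ck k U f -> Ck k U (fun z => L (f z)).
Proof.
move=> oU cL; elim: k f => [|k IH] f fC.
  split=> // z Uz; apply: (@differentiable_comp _ _ _ _ f L).
    exact: Ck_diff fC Uz.
  exact: linear_differentiable.
have dL z : U z -> differentiable (fun z => L (f z)) z.
  move=> Uz; apply: (@differentiable_comp _ _ _ _ f L).
    exact: Ck_diff fC Uz.
  exact: linear_differentiable.
split=> // v; have fCv := fC.2 v.
apply: (Ck_eq oU _ (IH _ fCv)) => z Uz.
have df := Ck_diff fC Uz.
rewrite (deriveE _ (dL z Uz)) deriveE //.
have -> : (fun z => L (f z)) = L \o f by [].
have dL' : differentiable L (f z) by exact: linear_differentiable.
by rewrite (diff_comp df dL') /= diff_lin.
Qed.


Lemma scaler_bilinear (W : normedModType R) : bilinear_for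
    (GRing.Scale.Law.clone _ _ *:%R _) (GRing.Scale.Law.clone _ _ *:%R _)
    (fun (a : R) (w : W) => a *: w).
Proof.
split=> [u'|u] a x y /=; first by rewrite scalerDl scalerA.
by rewrite scalerDr !scalerA mulrC.
Qed.

Lemma scale_is_diff (V W : normedModType R) (f : V -> R) (g : V -> W) z :
  differentiable f z -> differentiable g z ->
  is_diff z (fun z => f z *: g z) (fun v => f z *: 'd g z v + 'd f z v *: g z).
Proof.
move=> df dg.
pose M := bilinear_isBilinear.Build R R W W _ _ (fun (a : R) (w : W) => a *: w)
  (@scaler_bilinear W).
pose B : {bilinear R -> W -> W} := HB.pack (fun (a : R) (w : W) => a *: w) M.
have cB : continuous (fun p : R * W => B p.1 p.2) by exact: scale_continuous.
have H : is_diff (f z, g z) (fun p => B p.1 p.2) (fun q => f z *: q.2 + q.1 *: g z).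
  apply: DiffDef; first exact: differentiable_bilin.
  by rewrite diff_bilin.
have H2 : is_diff z (fun z => (f z, g z)) (fun v => ('d f z v, 'd g z v)).
  by apply: DiffDef; [exact: differentiable_pair|rewrite diff_pair].
exact: (is_diff_comp H2 H).
Qed.

Lemma differentiableS (V W : normedModType R) (f : V -> R) (g : V -> W) z :
  differentiable f z -> differentiable g z ->
  differentiable (fun z => f z *: g z) z.
Proof. by move=> df dg; have [] := scale_is_diff df dg. Qed.

Lemma deriveS (V W : normedModType R) (f : V -> R) (g : V -> W) z v :
  differentiable f z -> differentiable g z ->
  'D_v (fun z => f z *: g z) z = f z *: 'D_v g z + 'D_v f z *: g z.
Proof.
move=> df dg; have [d E] := scale_is_diff df dg.
by rewrite (deriveE _ d) E (deriveE _ df) (deriveE _ dg).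
Qed.

Lemma CkS (V W : normedModType R) k (U : set V) (f : V -> R) (g : V -> W) :
  open U -> Ck k U f -> Ck k U g -> Ck k U (fun z => f z *: g z).
Proof.
move=> oU; elim: k f g => [|k IH] f g fC gC.
  by split=> // z Uz; apply: differentiableS; [exact: Ck_diff fC Uz|exact: Ck_diff gC Uz].
split=> [z Uz|v].
  by apply: differentiableS; [exact: Ck_diff fC Uz|exact: Ck_diff gC Uz].
have fCv := fC.2 v; have gCv := gC.2 v.
apply: (Ck_eq oU _ (CkD oU (IH _ _ (CkW fC) gCv) (IH _ _ fCv (CkW gC)))) => z Uz.
by rewrite /= deriveS //; [exact: Ck_diff fC Uz|exact: Ck_diff gC Uz].
Qed.

Lemma CkM (V : normedModType R) k (U : set V) (f g : V -> R) :
  open U -> Ck k U f -> Ck k U g -> Ck k U (fun z => f z * g z).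
Proof. exact: CkS. Qed.

Lemma Ck_prod (V : normedModType R) k (U : set V) (I : Type) (s : seq I) (P : pred I)
  (f : I -> V -> R) :
  open U -> (forall i, P i -> Ck k U (f i)) -> Ck k U (fun z => \prod_(i <- s | P i) f i z).
Proof.
move=> oU fC; elim: s => [|i s IH].
  by apply: (Ck_eq oU _ (Ck_cst k U (1 : R))) => z _; rewrite big_nil.
case: (boolP (P i)) => Pi; last first.
  by apply: (Ck_eq oU _ IH) => z _; rewrite big_cons (negbTE Pi).
by apply: (Ck_eq oU _ (CkM oU (fC i Pi) IH)) => z _; rewrite big_cons Pi.
Qed.

(** The chain rule writes a derivative of g o f as a finite sum of products
    of lower order, namely the partial derivatives of g along the basis e,
    composed with f, times the coordinates of a derivative of f. The
    coordinates c let row vectors and scalars be treated at once. *)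
Lemma Ck_comp (U V W : normedModType R) m (e : 'I_m -> V) (c : 'I_m -> V -> R)
    k (A : set U) (B : set V) (f : U -> V) (g : V -> W) :
  (forall j, linear (c j)) -> (forall j, continuous (c j)) ->
  (forall v, v = \sum_j c j v *: e j) ->
  open A -> (forall z, A z -> B (f z)) ->
  Ck k A f -> Ck k B g -> Ck k A (fun z => g (f z)).
Proof.
move=> lc cc ce oA fB.
pose cM j := GRing.isLinear.Build R V R *:%R (c j) (lc j).
pose cL j : {linear V -> R} := HB.pack (c j) (cM j).
have dgf k' f' g' z : Ck k' A f' -> Ck k' B g' -> (forall z, A z -> B (f' z)) -> A z ->
    differentiable (fun z => (g' : V -> W) (f' z)) z.
  move=> fC gC f'B Az; apply: (@differentiable_comp _ _ _ _ f' g').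
    exact: Ck_diff fC Az.
  by apply: Ck_diff gC _; exact: f'B.
elim: k g => [|k IH] g fC gC.
  by split=> // z; exact: (dgf _ _ _ _ fC gC fB).
split=> [z|v]; first exact: (dgf _ _ _ _ fC gC fB).
have : Ck k A (fun z => \sum_j c j ('D_v f z) *: 'D_(e j) g (f z)).
  apply: Ck_sum => // j _; apply: CkS => //.
    exact: (@Ck_lin _ _ _ k A (cL j) _ oA (cc j) (fC.2 v)).
  exact: (IH (fun y => 'D_(e j) g y) (CkW fC) (gC.2 (e j))).
apply: Ck_eq => // z Az.
have df := Ck_diff fC Az; have dg := Ck_diff gC (fB _ Az).
rewrite (deriveE _ (dgf _ _ _ _ fC gC fB Az)).
have -> : (fun z => g (f z)) = g \o f by [].
rewrite diff_comp //= -(deriveE _ df) [in RHS](ce ('D_v f z)) linear_sum.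
by apply: eq_bigr => j _; rewrite linearZ /= (deriveE _ dg).
Qed.

Lemma Ck_comp_rV (U W : normedModType R) m
    k (A : set U) (B : set 'rV[R]_m) (f : U -> 'rV[R]_m) (g : 'rV[R]_m -> W) :
  open A -> (forall z, A z -> B (f z)) ->
  Ck k A f -> Ck k B g -> Ck k A (fun z => g (f z)).
Proof.
apply: (@Ck_comp U _ W m (@basis_vec R m) (fun j v => v 0 j) k A B f g) => [j a u v|j v|v].
- by rewrite !mxE.
- exact: coord_continuous.
- exact: row_sum_delta.
Qed.

Lemma Ck_comp_R (U W : normedModType R)
    k (A : set U) (B : set R) (f : U -> R) (g : R -> W) :
  open A -> (forall z, A z -> B (f z)) ->
  Ck k A f -> Ck k B g -> Ck k A (fun z => g (f z)).
Proof.
apply: (@Ck_comp U R W 1%N (fun=> 1) (fun=> id) k A B f g).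
- by [].
- by move=> _ v; exact: cvg_id.
- by move=> v; rewrite big_ord1 /=; rewrite [RHS]mulr1.
Qed.

(** In one variable the derivative in direction v is v times h', so the
    elementary functions follow from their derivatives by induction on k. *)
Lemma Ck_R (h h' : R -> R) k (B : set R) : open B ->
  (forall x, B x -> is_derive x 1 h (h' x)) ->
  (if k is k'.+1 then Ck k' B h' else True) -> Ck k B h.
Proof.
move=> oB dh ck.
have D x : B x -> differentiable h x.
  by move=> Bx; apply/derivable1_diffP; have [] := dh _ Bx.
case: k ck => [_|k ck]; split=> // v.
apply: (Ck_eq oB _ (CkS oB (Ck_cst k B v) ck)) => z Bz.
rewrite deriveE; last exact: D.
by rewrite -[v in 'd _ _ v]mulr1 linearZ /= -deriveE ?(derive_val (is_derive := dh _ Bz)) //; exact: D.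
Qed.

Lemma Ck_expR k : Ck k setT (@expR R).
Proof.
by elim: k => [|k IH]; apply: (Ck_R (h' := expR)) => //; exact: openT.
Qed.

Lemma Ck_sincos k : Ck k setT (@sin R) /\ Ck k setT (@cos R).
Proof.
elim: k => [|k [IHs IHc]].
  by split; [apply: (Ck_R (h' := cos) openT)|apply: (Ck_R (h' := -%R \o sin) openT)].
split; first by apply: (Ck_R (h' := cos) openT).
apply: (Ck_R (h' := fun x => - sin x) openT).
apply: (Ck_eq openT _ (CkS openT (Ck_cst k setT (-1 : R)) IHs)) => z _.
by rewrite [LHS]mulN1r.
Qed.

Definition Rpos : set R := [set x | 0 < x].

Lemma open_Rpos : open Rpos.
Proof. exact: open_gt. Qed.

Lemma is_derive_inv (x : R) : x != 0 -> is_derive x 1 GRing.inv (- x^-2).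
Proof.
move=> x0; have := is_deriveV (f := id) x0 (is_derive_id x 1).
by rewrite [X in is_derive _ _ _ X]mulr1.
Qed.

Lemma Ck_inv k : Ck k Rpos (@GRing.inv R).
Proof.
elim: k => [|k IH].
  apply: (Ck_R (h' := fun x => - x^-2) open_Rpos) => // x x0.
  exact/is_derive_inv/lt0r_neq0.
apply: (Ck_R (h' := fun x => - x^-2) open_Rpos) => // [x x0|].
  exact/is_derive_inv/lt0r_neq0.
apply: (Ck_eq open_Rpos _ (CkS open_Rpos (Ck_cst k Rpos (-1 : R)) (CkM open_Rpos IH IH))) => z _.
by rewrite [LHS]mulN1r -expr2 exprVn.
Qed.

Lemma Ck_ln k : Ck k Rpos (@ln R).
Proof.
have dln x : Rpos x -> is_derive x 1 (@ln R) x^-1 by move=> x0; exact: is_derive1_ln.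
by case: k => [|k]; apply: (Ck_R open_Rpos dln); rewrite ?Ck_inv //; exact: Ck_inv.
Qed.

End Ck.

(** * Symmetry of second derivatives *)

Section Lines.
Context {R : realType}.

Lemma is_derive_line (V W : normedModType R) (f : V -> W) a u (s : R) :
  differentiable f (a + s *: u) ->
  is_derive s 1 (fun s => f (a + s *: u)) ('D_u f (a + s *: u)).
Proof.
move=> df.
have dl : is_diff s (fun s : R => a + s *: u) (fun h => h *: u).
  have := is_diffD (is_diff_cst a s) (is_diff_scalel s u).
  by rewrite add0r.
have df' : is_diff (a + s *: u) f ('d f (a + s *: u)) by exact: DiffDef.
have [d E] := is_diff_comp dl df'.
apply: DeriveDef; first exact: diff_derivable.
by rewrite (deriveE _ d) E /= scale1r (deriveE _ df).
Qed.

Lemma derive_sum_pderiv k (f : 'rV[R]_k -> R) z v : differentiable f z ->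
  'D_v f z = \sum_j v 0 j * pderiv j f z.
Proof.
move=> df; rewrite (deriveE _ df) [in LHS](row_sum_delta v) linear_sum.
by apply: eq_bigr => j _; rewrite linearZ /pderiv (deriveE _ df).
Qed.

Lemma continuous_line (V W : normedModType R) (f : V -> W) a u (A : set R) :
  (forall z, differentiable f z) -> {within A, continuous (fun s : R => f (a + s *: u))}.
Proof.
move=> df; apply: continuous_subspaceT => s.
apply: differentiable_continuous; apply/derivable1_diffP.
by have [] := is_derive_line (df (a + s *: u)).
Qed.

(** The mean value theorem is applied to the increment in direction v, as a
    function of the step along u, and then to the resulting derivative. *)
Lemma second_difference (V : normedModType R) (f : V -> R) z u v (h : R) :
  Ck 2 setT f -> 0 < h ->
  exists s t, [/\ 0 < s < h, 0 < t < h &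
    f (z + h *: u + h *: v) - f (z + h *: u) - f (z + h *: v) + f z =
    h * h * 'D_v (fun y => 'D_u f y) (z + s *: u + t *: v)].
Proof.
move=> fC h0.
have df y : differentiable f y by exact: (Ck_diff fC).
have df' y : differentiable (fun y => 'D_u f y) y by exact: (Ck_diff (Ck_derive u fC)).
pose p s := f (z + h *: v + s *: u) - f (z + s *: u).
have dp (s : R) : is_derive s 1 p ('D_u f (z + h *: v + s *: u) - 'D_u f (z + s *: u)).
  by apply: is_deriveB; exact: is_derive_line.
have [|s sI Es] := MVT h0 (fun s _ => dp s).
  apply: continuous_subspaceT => s; apply: differentiable_continuous.
  by apply/derivable1_diffP; have [] := dp s.
have [|t tI Et] := MVT h0 (fun t _ => is_derive_line (df' (z + s *: u + t *: v))).
  exact: (@continuous_line V R (fun y => 'D_u f y) (z + s *: u) v).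
exists s, t; rewrite !in_itv /= in sI tI; split=> //.
move: Es; rewrite /p !subr0 !scale0r !addr0.
move: Et; rewrite !subr0 scale0r addr0 => Et.
rewrite (addrAC z (h *: v) (s *: u)) Et.
rewrite (addrAC z (h *: u)) => E.
transitivity (f (z + h *: v + h *: u) - f (z + h *: u) - (f (z + h *: v) - f z)); first by ring.
by rewrite E; ring.
Qed.

Lemma close_both (a b c e : R) : `|a - c| < e / 2 -> `|b - c| < e / 2 -> `|a - b| <= e.
Proof.
move=> ac bc; rewrite (splitr e) (le_trans (ler_distD c a b))//.
by rewrite (distrC c) lerD// ltW.
Qed.

(** The second difference is symmetric in u and v, so each mixed derivative
    takes the same value h^-2 times that difference at some point at distance
    O(h) from z; let h tend to 0. *)
Lemma schwarz (V : normedModType R) (f : V -> R) z u v : Ck 2 setT f ->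
  'D_v (fun y => 'D_u f y) z = 'D_u (fun y => 'D_v f y) z.
Proof.
move=> fC.
have cA : {for z, continuous (fun y => 'D_v (fun y => 'D_u f y) y)}.
  by apply: differentiable_continuous; exact: (Ck_diff (Ck_derive v (Ck_derive u fC))).
have cB : {for z, continuous (fun y => 'D_u (fun y => 'D_v f y) y)}.
  exact/differentiable_continuous/(Ck_diff (Ck_derive u (Ck_derive v fC))).
set A : V -> R := fun y => 'D_v (fun y => 'D_u f y) y in cA *.
set B : V -> R := fun y => 'D_u (fun y => 'D_v f y) y in cB *.
suff : A z = B z by [].
apply/eqP; rewrite -subr_eq0 -normr_le0; apply/ler_addgt0Pl => _/posnumP[e].
rewrite addr0.
have e2 : 0 < e%:num / 2 by rewrite divr_gt0.
move/cvgrPdist_lt : cA => /(_ _ e2) /nbhs_ballP [d1 /= d10 H1].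
move/cvgrPdist_lt : cB => /(_ _ e2) /nbhs_ballP [d2 /= d20 H2].
(* K h is the least of d1 and d2, so both points of the second differences with
   step h, where A and B are evaluated, lie in the two balls. *)
pose K := `|u| + `|v| + 1.
have K0 : 0 < K by rewrite ltr_wpDl// addr_ge0.
pose h := Num.min d1 d2 / K.
have h0 : 0 < h by rewrite divr_gt0// lt_min d10.
have hb s t (a b : V) : `|a| + `|b| + 1 = K -> 0 < s < h -> 0 < t < h ->
    `|z - (z + s *: a + t *: b)| < Num.min d1 d2.
  move=> KE /andP[s0 sh] /andP[t0 th].
  rewrite -addrA opprD addNKr normrN (le_lt_trans (ler_normD _ _))// !normrZ.
  rewrite !gtr0_norm//.
  apply: (@le_lt_trans _ _ (h * `|a| + h * `|b|)).
    by rewrite lerD// ler_wpM2r// ltW.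
  rewrite -mulrDr; apply: (@lt_le_trans _ _ (h * K)); last by rewrite /h divfK// gt_eqF.
  by rewrite ltr_pM2l// -KE ltrDl.
have [s [t [sh th E]]] := second_difference z u v fC h0.
have [s' [t' [sh' th' E']]] := second_difference z v u fC h0.
have AB : A (z + s *: u + t *: v) = B (z + s' *: v + t' *: u).
  have hh : h * h != 0 by rewrite mulf_neq0// gt_eqF.
  apply: (mulfI hh); apply: (eq_trans (esym E)); apply: (eq_trans _ E').
  rewrite (addrAC z (h *: v)); congr (_ + _); exact: addrAC.
have := hb _ _ u v erefl sh th; rewrite lt_min => /andP[q1 _].
have := hb _ _ v u _ sh' th'; rewrite lt_min (addrC `|v|) => /(_ erefl) /andP[_ q2].
have := H1 (z + s *: u + t *: v); rewrite -ball_normE /= => /(_ q1) r1.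
have := H2 (z + s' *: v + t' *: u); rewrite -ball_normE /= => /(_ q2) r2.
by rewrite -AB in r2; exact: (close_both r1 r2).
Qed.

End Lines.

(** * Strictly convex functions *)

Section Convex.
Context {R : realType} {k : nat}.
Implicit Types f : 'rV[R]_k -> R.

Lemma quad_formE (A : 'M[R]_k) (u : 'rV[R]_k) :
  (u *m A *m u^T) 0 0 = \sum_i \sum_j u 0 i * u 0 j * A i j.
Proof.
rewrite !mxE exchange_big /=; apply: eq_bigr => j _.
by rewrite !mxE mulr_suml; apply: eq_bigr => i _; rewrite mulrAC.
Qed.

Lemma smooth_pderiv (U : set 'rV[R]_k) f j : smooth_on U f -> smooth_on U (pderiv j f).
Proof. exact: smooth_onD. Qed.

Lemma derive2_hessian f x u : smooth_on setT f ->
  'D_u (fun y => 'D_u f y) x = (u *m hessian f x *m u^T) 0 0.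
Proof.
move=> fs.
have df y : differentiable f y by exact: (fs [::] y).
have dpf j y : differentiable (pderiv j f) y by exact: (fs [:: basis_vec R j] y).
have -> : (fun y => 'D_u f y) = \sum_j (fun y => u 0 j * pderiv j f y).
  by apply/funext => y; rewrite derive_sum_pderiv // fct_sumE.
rewrite derive_sum => [|j]; last by apply: derivableM => //; exact: diff_derivable.
rewrite quad_formE exchange_big; apply: eq_bigr => j _ /=.
rewrite deriveZ; last exact: diff_derivable.
rewrite derive_sum_pderiv // scaler_sumr; apply: eq_bigr => i _.
by rewrite !mxE /GRing.scale /=; ring.
Qed.

(** Along the segment from x0 to x the derivative vanishes at x0 and
    increases strictly. *)
Lemma strictly_convex_critical_lt f x0 x : strictly_convex f ->
  critical_point f x0 -> x != x0 -> f x0 < f x.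
Proof.
move=> [fs fp] c0 xx0; pose u := x - x0.
have u0 : u != 0 by rewrite subr_eq0.
have df y : differentiable f y by exact: (fs [::] y).
have dfu y : differentiable (fun y => 'D_u f y) y by exact: (fs [:: u] y).
have [|s sI Es] := MVT ltr01 (fun s _ => is_derive_line (df (x0 + s *: u))).
  exact: (@continuous_line R _ R f x0 u).
have s0 : 0 < s by move: sI; rewrite in_itv /= => /andP[].
have [|t tI Et] := MVT s0 (fun t _ => is_derive_line (dfu (x0 + t *: u))).
  exact: (@continuous_line R _ R (fun y => 'D_u f y) x0 u).
move: Es; rewrite scale1r scale0r addr0 subr0 mulr1 {1}/u (addrC x0) subrK => Es.
rewrite -subr_gt0 Es.
have [_ D0] := c0 u.
move: Et; rewrite scale0r addr0 D0 !subr0 derive2_hessian // => ->.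
by rewrite mulr_gt0 //; exact: fp.
Qed.

Lemma critical_point_max f x0 : (forall y, differentiable f y) ->
  (forall x, f x <= f x0) -> critical_point f x0.
Proof.
move=> df fmax v.
have dl s : derivable (fun s : R => f (x0 + s *: v)) s 1.
  by have [] := is_derive_line (df (x0 + s *: v)).
have N11 : (-1 : R) <= 1 by rewrite (le_trans (lerN10 R) ler01).
have I0 : (0 : R) \in `](-1), 1[ by rewrite in_itv /= ltrN10 ltr01.
have M0 t : t \in `](-1 : R), 1[ -> f (x0 + t *: v) <= f (x0 + 0 *: v).
  by move=> _; rewrite scale0r addr0.
have [_ E] := @derive1_at_max R (fun s => f (x0 + s *: v)) _ _ _ N11
  (fun s _ => dl s) I0 M0.
apply: DeriveDef; first exact: diff_derivable.
have [_] := is_derive_line (df (x0 + 0 *: v)).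
by rewrite E scale0r addr0.
Qed.

Lemma critical_pointP f x : differentiable f x ->
  critical_point f x <-> forall v, 'D_v f x = 0.
Proof.
move=> df; split=> [c v|c v]; first by have [] := c v.
by apply: DeriveDef; [exact: diff_derivable|exact: c].
Qed.

Lemma differentiable_expR (V : normedModType R) (f : V -> R) y :
  differentiable f y -> differentiable (fun y => expR (f y)) y.
Proof.
move=> df; apply: (@differentiable_comp _ _ _ _ f expR) => //.
exact/derivable1_diffP/derivable_expR.
Qed.

Lemma derive_comp_R (V : normedModType R) (f : V -> R) (h : R -> R) (h' : R) y v :
  differentiable f y -> is_derive (f y) 1 h h' ->
  'D_v (fun y => h (f y)) y = h' * 'D_v f y.
Proof.
move=> df [dh Eh].
have dh' : differentiable h (f y) by exact/derivable1_diffP.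
have dc := differentiable_comp df dh'.
rewrite (deriveE _ dc) (diff_comp df dh') /= -(deriveE _ df).
by rewrite -[X in 'd _ _ X]mulr1 [LHS]linearZ /= -(deriveE _ dh') Eh mulrC.
Qed.

Lemma derive_expR_comp (V : normedModType R) (f : V -> R) y v :
  differentiable f y -> 'D_v (fun y => expR (f y)) y = expR (f y) * 'D_v f y.
Proof. by move=> df; apply: derive_comp_R. Qed.

Lemma smooth_expR (V : normedModType R) (U : set V) (f : V -> R) : open U ->
  smooth_on U f -> smooth_on U (fun y => expR (f y)).
Proof.
move=> oU /smooth_onP fs; apply/smooth_onP => m.
by apply: (Ck_comp_R oU _ (fs m) (Ck_expR m)).
Qed.

Lemma pos_sum_square (a b c : R) : 0 < a -> 0 < b -> 0 < a * b + c * (a * c).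
Proof.
move=> a0 b0; apply: ltr_pwDl; first exact: mulr_gt0.
by rewrite mulrCA -expr2; apply: mulr_ge0; [exact: ltW|exact: sqr_ge0].
Qed.

(** Hess (e^f) = e^f (Hess f + df^T df), where the second summand is
    positive semidefinite. *)
Lemma strictly_convex_expR f : strictly_convex f ->
  strictly_convex (fun x => expR (f x)).
Proof.
move=> [fs fp]; split=> [|x v v0]; first by apply: smooth_expR => //; exact: openT.
have df y : differentiable f y by exact: (fs [::] y).
have dfv y : differentiable (fun y => 'D_v f y) y by exact: (fs [:: v] y).
rewrite -derive2_hessian; last by apply: smooth_expR => //; exact: openT.
have -> : (fun y => 'D_v (fun x => expR (f x)) y) =
    (fun y => expR (f y)) * (fun y => 'D_v f y).
  by apply/funext => y; rewrite derive_expR_comp.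
rewrite deriveM; [|exact/diff_derivable/differentiable_expR|exact: diff_derivable].
rewrite derive_expR_comp // derive2_hessian // /GRing.scale /=.
exact: pos_sum_square (expR_gt0 _) (fp x v v0).
Qed.

End Convex.

(** * Derivatives of determinants and inverse matrices *)

Section MatrixCalculus.
Context {R : realType} {V : normedModType R} {n : nat}.
Implicit Types M N : V -> 'M[R]_n.

Definition mxderive (v : V) M (z : V) : 'M[R]_n :=
  \matrix_(i, j) 'D_v (fun y => M y i j) z.

Definition mxdifferentiable M (z : V) :=
  forall i j, differentiable (fun y => M y i j) z.

Lemma differentiable_prod (I : Type) (r : seq I) (P : pred I) (f : I -> V -> R) z :
  (forall i, differentiable (f i) z) ->
  differentiable (fun y => \prod_(i <- r | P i) f i y) z.
Proof.
move=> df; elim: r => [|i r IH].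
  rewrite (_ : (fun _ => _) = cst 1); first exact: differentiable_cst.
  by apply/funext => y; rewrite big_nil.
case: (boolP (P i)) => Pi; last first.
  rewrite (_ : (fun _ => _) = (fun y => \prod_(j <- r | P j) f j y)) //.
  by apply/funext => y; rewrite big_cons (negbTE Pi).
rewrite (_ : (fun _ => _) = f i * (fun y => \prod_(j <- r | P j) f j y)).
  exact: differentiableM.
by apply/funext => y; rewrite big_cons Pi.
Qed.

Lemma derive_prod (I : eqType) (r : seq I) (f : I -> V -> R) z v : uniq r ->
  (forall i, differentiable (f i) z) ->
  'D_v (fun y => \prod_(i <- r) f i y) z =
  \sum_(i <- r) 'D_v (f i) z * \prod_(j <- r | j != i) f j z.
Proof.
move=> + df; elim: r => [_|i r IH] /=.
  rewrite (_ : (fun _ => _) = cst 1); last by apply/funext => y; rewrite big_nil.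
  by rewrite derive_cst big_nil.
move=> /andP[ir ur].
rewrite (_ : (fun _ => _) = f i * (fun y => \prod_(j <- r) f j y)); last first.
  by apply/funext => y; rewrite big_cons.
rewrite deriveM; [|exact: diff_derivable|]; last first.
  exact/diff_derivable/differentiable_prod.
rewrite big_cons IH // addrC; congr (_ + _).
  rewrite big_cons eqxx /= [LHS]mulrC; congr (_ * _).
  rewrite [LHS]big_seq [RHS]big_seq_cond; apply: eq_bigl => j.
  by case: eqVneq => [->|]; rewrite ?(negbTE ir) ?andbT.
rewrite [LHS]mulr_sumr [LHS]big_seq [RHS]big_seq; apply: eq_bigr => j jr.
rewrite big_cons (_ : i != j) /=; last by apply: contraNneq ir => ->.
by rewrite mulrCA.
Qed.

Lemma differentiable_bigsum (I : Type) (r : seq I) (P : pred I) (f : I -> V -> R) z :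
  (forall i, differentiable (f i) z) ->
  differentiable (fun y => \sum_(i <- r | P i) f i y) z.
Proof.
move=> df; elim: r => [|i r IH].
  rewrite (_ : (fun _ => _) = cst 0); first exact: differentiable_cst.
  by apply/funext => y; rewrite big_nil.
case: (boolP (P i)) => Pi; last first.
  rewrite (_ : (fun _ => _) = (fun y => \sum_(j <- r | P j) f j y)) //.
  by apply/funext => y; rewrite big_cons (negbTE Pi).
rewrite (_ : (fun _ => _) = f i + (fun y => \sum_(j <- r | P j) f j y)).
  exact: differentiableD.
by apply/funext => y; rewrite big_cons Pi.
Qed.

Lemma derive_bigsum (I : Type) (r : seq I) (P : pred I) (f : I -> V -> R) z v :
  (forall i, differentiable (f i) z) ->
  'D_v (fun y => \sum_(i <- r | P i) f i y) z = \sum_(i <- r | P i) 'D_v (f i) z.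
Proof.
move=> df; elim: r => [|i r IH].
  rewrite (_ : (fun _ => _) = cst 0) ?derive_cst ?big_nil //.
  by apply/funext => y; rewrite big_nil.
rewrite big_cons; case: ifP => Pi; last first.
  rewrite -IH; congr ('D_v _ z).
  by apply/funext => y; rewrite big_cons Pi.
rewrite -IH -deriveD; first last.
- exact/diff_derivable/differentiable_bigsum.
- exact: diff_derivable.
by congr ('D_v _ z); apply/funext => y; rewrite big_cons Pi.
Qed.

Lemma differentiable_scale (c : R) (f : V -> R) z :
  differentiable f z -> differentiable (fun y => c * f y) z.
Proof. by move=> df; exact: (@differentiableZ _ _ _ f c z df). Qed.

Lemma derive_scale (c : R) (f : V -> R) z v :
  differentiable f z -> 'D_v (fun y => c * f y) z = c * 'D_v f z.
Proof. by move=> df; apply: (@deriveZ _ _ _ f c z v); exact: diff_derivable. Qed.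

Lemma differentiable_det M z : mxdifferentiable M z ->
  differentiable (fun y => \det (M y)) z.
Proof.
move=> dM; rewrite /determinant; apply: differentiable_bigsum => s.
by apply: differentiable_scale; apply: differentiable_prod.
Qed.

(** By multilinearity in the rows, the derivative is the sum over i of the
    determinants in which row i is differentiated, each expanded along row i. *)
Lemma derive_det_sum M z v : mxdifferentiable M z ->
  'D_v (fun y => \det (M y)) z =
  \sum_i \sum_j 'D_v (fun y => M y i j) z * cofactor (M z) i j.
Proof.
move=> dM.
pose N i := \matrix_(k, j) (if k == i then 'D_v (fun y => M y i j) z else M z k j).
transitivity (\sum_i \det (N i)); last first.
  apply: eq_bigr => i _; rewrite (expand_det_row _ i); apply: eq_bigr => j _.
  rewrite mxE eqxx; congr (_ * _); rewrite /cofactor; congr (_ * \det _).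
  by apply/matrixP => a b; rewrite !mxE eq_sym (negbTE (neq_lift _ _)).
rewrite /determinant exchange_big derive_bigsum /=; last first.
  by move=> s; apply: differentiable_scale; apply: differentiable_prod.
apply: eq_bigr => s _; rewrite derive_scale; last exact: differentiable_prod.
rewrite derive_prod ?index_enum_uniq // mulr_sumr; apply: eq_bigr => i _.
congr (_ * _); rewrite [RHS](bigD1 i) //= mxE eqxx; congr (_ * _).
by apply: eq_bigr => j ji; rewrite mxE (negbTE ji).
Qed.

Lemma Ck_det k (U : set V) M : open U ->
  (forall i j, Ck k U (fun y => M y i j)) -> Ck k U (fun y => \det (M y)).
Proof.
move=> oU CM; rewrite /determinant; apply: Ck_sum => // s _.
apply: CkM => //; first exact: Ck_cst.
by apply: Ck_prod.
Qed.

End MatrixCalculus.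

Section InverseMatrix.
Context {R : realType} {V : normedModType R} {n : nat}.
Implicit Types M N : V -> 'M[R]_n.

Lemma mxdifferentiable_inv M z : mxdifferentiable M z ->
  (forall y, \det (M y) != 0) -> mxdifferentiable (fun y => invmx (M y)) z.
Proof.
move=> dM dn0 i j.
rewrite (_ : (fun y => _) = (fun y => (\det (M y))^-1) * (fun y => cofactor (M y) j i)).
  apply: differentiableM.
    by apply: differentiableV => //; exact: differentiable_det.
  apply: differentiable_scale; apply: differentiable_det => a b.
  rewrite (_ : (fun y => _) = (fun y => M y (lift j a) (lift i b))); first exact: dM.
  by apply/funext => y; rewrite !mxE.
by apply/funext => y; rewrite /invmx unitmxE unitfE dn0 !mxE.
Qed.

Lemma mxderive_mul M N z v : mxdifferentiable M z -> mxdifferentiable N z ->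
  mxderive v (fun y => M y *m N y) z = mxderive v M z *m N z + M z *m mxderive v N z.
Proof.
move=> dM dN; apply/matrixP => i j; rewrite !mxE.
rewrite (_ : (fun y => _) = (fun y => \sum_k ((fun y => M y i k) * (fun y => N y k j)) y)); last first.
  by apply/funext => y; rewrite mxE.
rewrite derive_bigsum => [|k]; last exact: differentiableM.
rewrite -big_split; apply: eq_bigr => k _ /=.
rewrite deriveM; [|exact: diff_derivable|exact: diff_derivable].
by rewrite !mxE addrC /GRing.scale /= [N z k j * _]mulrC.
Qed.

Lemma mxdifferentiable_mul M N z : mxdifferentiable M z -> mxdifferentiable N z ->
  mxdifferentiable (fun y => M y *m N y) z.
Proof.
move=> dM dN i j.
rewrite (_ : (fun y => _) = (fun y => \sum_k ((fun y => M y i k) * (fun y => N y k j)) y)); last first.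
  by apply/funext => y; rewrite mxE.
by apply: differentiable_bigsum => k; exact: differentiableM.
Qed.

Lemma mxderive_inv M z v : mxdifferentiable M z -> (forall y, \det (M y) != 0) ->
  mxderive v (fun y => invmx (M y)) z = - (invmx (M z) *m mxderive v M z *m invmx (M z)).
Proof.
move=> dM dn0.
have uM y : M y \in unitmx by rewrite unitmxE unitfE.
have := mxderive_mul v (mxdifferentiable_inv dM dn0) dM.
rewrite (_ : mxderive _ _ _ = 0); last first.
  apply/matrixP => i j; rewrite !mxE.
  rewrite (_ : (fun y => _) = cst ((1%:M : 'M[R]_n) i j)) ?derive_cst //.
  by apply/funext => y; rewrite mulVmx.
move=> /esym/eqP; rewrite addr_eq0 => /eqP E.
by rewrite -[LHS]mulmx1 -(mulmxV (uM z)) mulmxA E mulNmx.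
Qed.

Lemma derive_ln_det M z v : mxdifferentiable M z -> (forall y, 0 < \det (M y)) ->
  'D_v (fun y => ln (\det (M y))) z = \tr (invmx (M z) *m mxderive v M z).
Proof.
move=> dM dp.
rewrite (derive_comp_R v (differentiable_det dM) (is_derive1_ln (dp z))).
rewrite derive_det_sum // mulr_sumr /mxtrace.
under [RHS]eq_bigr do rewrite mxE.
rewrite exchange_big /=; apply: eq_bigr => i _.
rewrite mulr_sumr; apply: eq_bigr => j _.
rewrite /invmx unitmxE unitfE gt_eqF //= !mxE; ring.
Qed.

End InverseMatrix.

(** * Block diagonal metrics *)

Section BlockMetric.
Context {R : realType} {n : nat}.
Local Notation lv := (@lsubmx R 1 n n).

Lemma posdef_det_neq0 k (A : 'M[R]_k) : posdef A -> \det A != 0.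
Proof.
move=> pA; apply/negP => /det0P [v v0 vA].
by have := pA v v0; rewrite vA mul0mx mxE ltxx.
Qed.

(** On the segment from the identity matrix to A all matrices are positive
    definite, so the determinant does not vanish there and keeps its sign. *)
Lemma posdef_det_gt0 k (A : 'M[R]_k) : posdef A -> 0 < \det A.
Proof.
move=> pA.
pose B (t : R) : 'M[R]_k := (1 - t) *: 1%:M + t *: A.
have dB (t : R) : differentiable (fun t => \det (B t)) t.
  apply: differentiable_det => i j.
  rewrite (_ : (fun y => _) = cst (1%:M i j) + (fun y => (A i j - 1%:M i j) * y)).
    apply: differentiableD => //; exact: differentiable_scale.
  by apply/funext => y; rewrite fctE !mxE; ring.
have pB t : 0 <= t <= 1 -> \det (B t) != 0.
  move=> /andP[t0 t1]; apply: posdef_det_neq0 => v v0.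
  have -> : (v *m B t *m v^T) 0 0 =
      (1 - t) * (v *m v^T) 0 0 + t * (v *m A *m v^T) 0 0.
    rewrite /B mulmxDr mulmxDl -!scalemxAr -!scalemxAl mulmx1 [LHS]mxE.
    by congr (_ + _); exact: mxE.
  have vv : 0 < (v *m v^T) 0 0.
    rewrite mxE (_ : \sum_j _ = \sum_j v 0 j ^+ 2); last first.
      by apply: eq_bigr => j _; rewrite mxE expr2.
    rewrite lt_def sumr_ge0 ?andbT => [|j _]; last exact: sqr_ge0.
    apply: contraNneq v0 => /eqP; rewrite psumr_eq0 => [/allP H|j _]; last exact: sqr_ge0.
    apply/eqP/rowP => j; rewrite mxE.
    by have /implyP/(_ isT) := H j (mem_index_enum _); rewrite sqrf_eq0 => /eqP.
  have := pA v v0; set a := (v *m v^T) 0 0 in vv *; set b := (_ *m _ *m _) 0 0 => b0.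
  have [->|tn0] := eqVneq t 0; first by rewrite subr0 mul1r mul0r addr0.
  apply: ltr_wpDl; first by rewrite mulr_ge0 ?subr_ge0 // ltW.
  by rewrite mulr_gt0 // lt_def tn0.
have B1 : B 1 = A by rewrite /B subrr scale0r add0r scale1r.
have B0 : B 0 = 1%:M by rewrite /B subr0 scale0r addr0 scale1r.
rewrite -B1 ltNge; apply/negP => B1le.
have cB : {within `[0, 1], continuous (fun t => \det (B t))}.
  by apply: continuous_subspaceT => t; exact: differentiable_continuous.
have [|t tI] := @IVT _ _ _ _ 0 ler01 cB.
  by rewrite B0 det1 ge_min le_max ler01 B1le orbT.
by apply/eqP/pB; move: tI; rewrite in_itv.
Qed.

Lemma lsubmxD_delta (h : R) (k : 'I_n) (z : 'rV[R]_(n + n)) :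
  lv (h *: basis_vec R (lshift n k) + z) = h *: basis_vec R k + lv z.
Proof.
by apply/rowP => j; rewrite !mxE; congr (h * _ + _).
Qed.

Lemma lsubmxD_delta0 (h : R) (k : 'I_n) (z : 'rV[R]_(n + n)) :
  lv (h *: basis_vec R (rshift n k) + z) = lv z.
Proof. by apply/rowP => j; rewrite !mxE eq_lrshift andbF mulr0 add0r. Qed.

Lemma pderiv_lsubmx k (f : 'rV[R]_n -> R) z :
  pderiv (lshift n k) (fun a => f (lv a)) z = pderiv k f (lv z).
Proof.
rewrite /pderiv /derive; congr (lim (_ @ 0^')).
by apply/funext => h /=; rewrite lsubmxD_delta.
Qed.

Lemma pderiv_lsubmx0 k (f : 'rV[R]_n -> R) z :
  pderiv (rshift n k) (fun a => f (lv a)) z = 0.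
Proof.
apply: etrans (derive_cst (f (lv z)) z (basis_vec R (rshift n k))).
rewrite /pderiv /derive; congr (lim (_ @ 0^')).
by apply/funext => h /=; rewrite lsubmxD_delta0.
Qed.

Lemma pderiv_cst k (c : R) (z : 'rV[R]_k) j : pderiv j (fun=> c) z = 0.
Proof. exact: (derive_cst c). Qed.

Lemma invmx_block_diag2 (A B : 'M[R]_n) : A \in unitmx -> B \in unitmx ->
  invmx (block_mx A 0 0 B) = block_mx (invmx A) 0 0 (invmx B).
Proof.
move=> uA uB.
have E : block_mx A 0 0 B *m block_mx (invmx A) 0 0 (invmx B) = 1%:M.
  by rewrite mulmx_block !mulmx0 !mul0mx !addr0 add0r !mulmxV // -scalar_mx_block.
by rewrite -[RHS]mul1mx -(mulVmx (mulmx1_unit E).1) -mulmxA E mulmx1.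
Qed.

End BlockMetric.

(** * Hessian metrics *)

Lemma smooth_differentiable (R : realType) (V W : normedModType R) (f : V -> W) :
  smooth_on setT f -> forall x, differentiable f x.
Proof. by move=> fs x; exact: (fs [::] x Logic.I). Qed.

(** By the last field and symmetry, d_k P_ij is symmetric in all three
    indices, as it is when P is the Hessian of a function. *)
Record hessian_metric (R : realType) (n : nat) (P : 'rV[R]_n -> 'M[R]_n) : Prop :=
  HessianMetric {
  hm_smooth : forall i j, smooth_on setT (fun x => P x i j);
  hm_sym : forall x i j, P x i j = P x j i;
  hm_pos : forall x, posdef (P x);
  hm_codazzi : forall x i j k,
    pderiv k (fun y => P y i j) x = pderiv j (fun y => P y i k) x }.

Lemma eq_sum_add2 (R : realType) (n : nat) (a b c d : 'I_n -> R) :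
  (forall l, a l + 2 * b l = c l + 2 * d l) ->
  \sum_l a l + 2 * \sum_l b l = \sum_l c l + 2 * \sum_l d l.
Proof.
by move=> H; rewrite !mulr_sumr -!big_split; apply: eq_bigr => l _; exact: H.
Qed.

Lemma eq_addl (R : realType) (a a' b c c' d : R) :
  a = a' -> c = c' -> a + b = c + d -> a' + b = c' + d.
Proof. by move=> <- <-. Qed.

Section HessianMetric.
Context {R : realType} {n : nat} (P : 'rV[R]_n -> 'M[R]_n) (hP : hessian_metric P).
Local Notation lv := (@lsubmx R 1 n n).
Local Notation e_ := (basis_vec R).

(** The logarithm of the Riemannian volume density of P. *)
Definition half_log_det (x : 'rV[R]_n) : R := 2^-1 * ln (\det (P x)).

(** The Levi-Civita connection of P: the entry (l, j) of [conn i] is the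
    Christoffel symbol with upper index l and lower indices i, j. Total symmetry of
    d_k P_ij cancels two of the three terms in the usual formula. *)
Definition conn (i : 'I_n) (x : 'rV[R]_n) : 'M[R]_n :=
  2^-1 *: (invmx (P x) *m mxderive (e_ i) P x).

Let dP x : mxdifferentiable P x.
Proof. by move=> i j; exact: (smooth_differentiable (hm_smooth hP i j) x). Qed.

Let detP x : 0 < \det (P x). Proof. exact/posdef_det_gt0/(hm_pos hP). Qed.

Let detPn0 x : \det (P x) != 0. Proof. exact: lt0r_neq0. Qed.

Let ddP i x : mxdifferentiable (mxderive (e_ i) P) x.
Proof.
move=> a b; rewrite (_ : (fun y => _) = (fun y => 'D_(e_ i) (fun y => P y a b) y)).
  exact: (smooth_differentiable (smooth_pderiv i (hm_smooth hP a b)) x).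
by apply/funext => y; rewrite mxE.
Qed.

Lemma smooth_ln_det : smooth_on setT (fun x => ln (\det (P x))).
Proof.
apply/smooth_onP => k; have oT := @openT 'rV[R]_n.
apply: (Ck_comp_R oT _ _ (Ck_ln k)) => [x _|]; first exact: detP.
by apply: Ck_det => // i j; exact: (smooth_onP _ _).1 (hm_smooth hP i j) k.
Qed.

Lemma smooth_half_log_det : smooth_on setT half_log_det.
Proof.
apply/smooth_onP => k; have oT := @openT 'rV[R]_n.
apply: CkM => //; first exact: Ck_cst.
exact: (smooth_onP _ _).1 smooth_ln_det k.
Qed.

Lemma connE i x l j :
  conn i x l j = 2^-1 * \sum_m invmx (P x) l m * pderiv i (fun y => P y m j) x.
Proof.
rewrite mxE [X in _ * X]mxE; congr (_ * _); apply: eq_bigr => m _.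
by rewrite [mxderive _ _ _ _ _]mxE.
Qed.

Let dlV x : differentiable half_log_det x.
Proof. exact: smooth_differentiable smooth_half_log_det x. Qed.

Lemma conn_sym i l j x : conn i x l j = conn j x l i.
Proof.
rewrite [LHS]connE.
rewrite (eq_bigr (fun m => invmx (P x) l m * pderiv j (fun y => P y m i) x)) => [|m _].
  by rewrite -connE.
by rewrite (hm_codazzi hP x m j i).
Qed.

Lemma conn_trace m x : \sum_l conn l x l m = pderiv m half_log_det x.
Proof.
rewrite /pderiv derive_scale; last exact: smooth_differentiable smooth_ln_det x.
rewrite derive_ln_det //; transitivity (\tr (conn m x)); last by rewrite mxtraceZ.
by rewrite /mxtrace; apply: eq_bigr => l _; exact: conn_sym.
Qed.

Lemma mxdifferentiable_scale (c : R) (M : 'rV[R]_n -> 'M[R]_n) x :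
  mxdifferentiable M x -> mxdifferentiable (fun y => c *: M y) x.
Proof.
move=> dM i j; rewrite (_ : (fun y => _) = (fun y => c * M y i j)).
  exact: differentiable_scale.
by apply/funext => y; rewrite mxE.
Qed.

Lemma mxderive_scale (c : R) (M : 'rV[R]_n -> 'M[R]_n) x v :
  mxdifferentiable M x -> mxderive v (fun y => c *: M y) x = c *: mxderive v M x.
Proof.
move=> dM; apply/matrixP => i j; rewrite !mxE -derive_scale //.
by congr ('D_v _ x); apply/funext => y; rewrite mxE.
Qed.

Lemma mxdifferentiable_conn i x : mxdifferentiable (conn i) x.
Proof.
apply: mxdifferentiable_scale; apply: mxdifferentiable_mul => //.
exact: mxdifferentiable_inv.
Qed.

Lemma differentiable_conn i l j x : differentiable (fun y => conn i y l j) x.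
Proof. exact: mxdifferentiable_conn. Qed.

(** After adding the quadratic term the derivative of the connection
    becomes symmetric in i and k, because second derivatives of P commute. *)
Lemma mxderive_conn k i x :
  mxderive (e_ k) (conn i) x + 2 *: (conn k x *m conn i x) =
  2^-1 *: (invmx (P x) *m mxderive (e_ k) (mxderive (e_ i) P) x).
Proof.
have dQ := mxdifferentiable_inv (dP x) detPn0.
rewrite mxderive_scale; last exact: mxdifferentiable_mul.
rewrite mxderive_mul // mxderive_inv //.
rewrite /conn -!scalemxAl -!scalemxAr !scalerA divff ?pnatr_eq0 // mul1r.
by rewrite scalerDr mulNmx !mulmxA scalerN addrAC addNr add0r.
Qed.

Lemma mxderive2_sym k i x :
  mxderive (e_ k) (mxderive (e_ i) P) x = mxderive (e_ i) (mxderive (e_ k) P) x.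
Proof.
apply/matrixP => a b; rewrite [LHS]mxE [RHS]mxE.
have E j : (fun y => mxderive (e_ j) P y a b) = (fun y => 'D_(e_ j) (fun y => P y a b) y).
  by apply/funext => y; rewrite mxE.
by rewrite !E; apply: schwarz; exact: (smooth_onP _ _).1 (hm_smooth hP a b) 2%N.
Qed.

(** A trace of the symmetry expressed by [mxderive_conn]. It is the
    only relation on first derivatives of Christoffel symbols that the
    computation of the Ricci tensor needs. *)
Lemma conn_identity i j x :
  \sum_l pderiv l (fun y => conn i y l j) x
    + 2 * \sum_m pderiv m half_log_det x * conn i x m j =
  pderiv i (pderiv j half_log_det) x + 2 * \sum_l \sum_m conn i x l m * conn j x m l.
Proof.
have -> : \sum_m pderiv m half_log_det x * conn i x m j =
    \sum_l (conn l x *m conn i x) l j.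
  under eq_bigr do rewrite -conn_trace mulr_suml.
  by rewrite exchange_big; apply: eq_bigr => l _; rewrite mxE.
have -> : \sum_l \sum_m conn i x l m * conn j x m l = \sum_l (conn i x *m conn l x) l j.
  apply: eq_bigr => l _; rewrite mxE; apply: eq_bigr => m _.
  exact: (congr1 (fun t => conn i x l m * t) (conn_sym j m l x)).
have -> : pderiv i (pderiv j half_log_det) x = \sum_l pderiv i (fun y => conn l y l j) x.
  rewrite /pderiv -derive_bigsum => [|l]; last exact: differentiable_conn.
  by congr ('D_(_) _ x); apply/funext => y; rewrite -/(pderiv _ _ _) -conn_trace.
apply: eq_sum_add2 => l.
have E (A B : 'M[R]_n) : (A + 2 *: B) l j = A l j + 2 * B l j.
  by rewrite mxE [X in _ + X]mxE.
have H : mxderive (e_ l) (conn i) x + 2 *: (conn l x *m conn i x) =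
    mxderive (e_ i) (conn l) x + 2 *: (conn i x *m conn l x).
  apply: etrans (mxderive_conn l i x) _; apply: etrans _ (esym (mxderive_conn i l x)).
  by rewrite mxderive2_sym.
move/matrixP/(_ l j): H; rewrite [LHS]E [RHS]E.
have Dc a b : mxderive (e_ a) (conn b) x l j = pderiv a (fun y => conn b y l j) x.
  exact: mxE.
exact: (eq_addl (Dc l i) (Dc i l)).
Qed.

End HessianMetric.

(** * Christoffel and Ricci tables of a tube metric *)

Section BlockTables.
Context {R : realType} {n : nat}.
Implicit Types (T K : 'I_n -> 'I_n -> 'I_n -> R).

(** The derivatives d_k G_ij of a metric G = diag (P, P) that depends only on
    the first n of its 2n coordinates, where T k i j stands for d_k P_ij. Such
    tables keep the index computations free of analysis. *)
Definition blockD T (k i j : 'I_(n + n)) : R :=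
  match fintype.split k, fintype.split i, fintype.split j with
  | inl k, inl i, inl j => T k i j
  | inl k, inr i, inr j => T k i j
  | _, _, _ => 0
  end.

(** The Christoffel symbols (upper index first) of G = diag (P, P), where K
    stands for those of P. *)
Definition blockG K (l i j : 'I_(n + n)) : R :=
  match fintype.split l, fintype.split i, fintype.split j with
  | inl l, inl i, inl j => K l i j
  | inl l, inr i, inr j => - K l i j
  | inr l, inl i, inr j => K l i j
  | inr l, inr i, inl j => K l i j
  | _, _, _ => 0
  end.

(** The derivatives of the Christoffel symbols of G = diag (P, P); the outer
    index k is the direction of differentiation. *)
Definition blockdG (dK : 'I_n -> 'I_n -> 'I_n -> 'I_n -> R) (k l i j : 'I_(n + n)) : R :=
  match fintype.split k with inl k => blockG (dK k) l i j | inr _ => 0 end.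

Lemma split_lshift (i : 'I_n) : fintype.split (lshift n i) = inl i.
Proof. exact: (unsplitK (inl i)). Qed.

Lemma split_rshift (i : 'I_n) : fintype.split (rshift n i) = inr i.
Proof. exact: (unsplitK (inr i)). Qed.

Let spE := (split_lshift, split_rshift).

Lemma blockDE T k i j :
  ((blockD T (lshift n k) (lshift n i) (lshift n j) = T k i j) *
   (blockD T (lshift n k) (rshift n i) (rshift n j) = T k i j) *
   (blockD T (lshift n k) (lshift n i) (rshift n j) = 0) *
   (blockD T (lshift n k) (rshift n i) (lshift n j) = 0))%type.
Proof. by rewrite /blockD !spE. Qed.

Lemma blockD0 T k i j : blockD T (rshift n k) i j = 0.
Proof. by rewrite /blockD !spE. Qed.

Lemma blockGE K l i j :
  ((blockG K (lshift n l) (lshift n i) (lshift n j) = K l i j) *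
   (blockG K (lshift n l) (rshift n i) (rshift n j) = - K l i j) *
   (blockG K (lshift n l) (lshift n i) (rshift n j) = 0) *
   (blockG K (lshift n l) (rshift n i) (lshift n j) = 0) *
   (blockG K (rshift n l) (lshift n i) (rshift n j) = K l i j) *
   (blockG K (rshift n l) (rshift n i) (lshift n j) = K l i j) *
   (blockG K (rshift n l) (lshift n i) (lshift n j) = 0) *
   (blockG K (rshift n l) (rshift n i) (rshift n j) = 0))%type.
Proof. by rewrite /blockG !spE. Qed.

Lemma blockdGE dK k l i j :
  ((blockdG dK (lshift n k) l i j = blockG (dK k) l i j) *
   (blockdG dK (rshift n k) l i j = 0))%type.
Proof. by rewrite /blockdG !spE. Qed.

Lemma christoffel_table (Q : 'M[R]_n) T l i j :
  (forall i j k, T i j k = T j i k) -> (forall i j k, T i j k = T i k j) ->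
  2^-1 * \sum_m block_mx Q 0 0 Q l m *
    (blockD T i m j + blockD T j m i - blockD T m i j) =
  blockG (fun l i j => 2^-1 * \sum_m Q l m * T i m j) l i j.
Proof.
move=> T12 T23.
case: (split_ordP l) => l' ->; rewrite big_split_ord /=.
  rewrite [X in _ + X]big1 ?addr0 => [|m _]; last by rewrite block_mxEur mxE mul0r.
  case: (split_ordP i) => i' ->; case: (split_ordP j) => j' ->; rewrite blockGE.
  - congr (_ * _); apply: eq_bigr => m _; rewrite block_mxEul !blockDE.
    by rewrite (T12 j') (T23 m j') addrK.
  - by rewrite big1 ?mulr0 // => m _; rewrite !blockDE !blockD0 !subr0 addr0 mulr0.
  - by rewrite big1 ?mulr0 // => m _; rewrite !blockDE !blockD0 !subr0 addr0 mulr0.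
  - rewrite -mulrN -sumrN; congr (_ * _); apply: eq_bigr => m _.
    by rewrite block_mxEul !blockDE !blockD0 !add0r mulrN (T12 m).
rewrite [X in X + _]big1 ?add0r => [|m _]; last by rewrite block_mxEdl mxE mul0r.
case: (split_ordP i) => i' ->; case: (split_ordP j) => j' ->; rewrite blockGE.
- by rewrite big1 ?mulr0 // => m _; rewrite !blockDE !blockD0 !subr0 addr0 mulr0.
- congr (_ * _); apply: eq_bigr => m _; rewrite block_mxEdr !blockDE !blockD0.
  by rewrite subr0 addr0.
- congr (_ * _); apply: eq_bigr => m _; rewrite block_mxEdr !blockDE !blockD0.
  by rewrite subr0 add0r (T12 j') (T23 m j') (T12 m).
- by rewrite big1 ?mulr0 // => m _; rewrite !blockD0 subr0 addr0 mulr0.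
Qed.

(** In the mixed blocks every term vanishes because a Christoffel symbol
    of G has an even number of indices among the last n. In the two diagonal
    blocks the derivatives of K are eliminated with the last hypothesis, and
    what remains is - h. *)
Lemma ricci_table K dK (c : 'I_n -> R) (h : 'I_n -> 'I_n -> R) :
  (forall l i j, K l i j = K l j i) ->
  (forall m, \sum_l K l l m = c m) ->
  (forall j i, \sum_l dK j l l i = h j i) ->
  (forall k l i j, dK k l i j = dK k l j i) ->
  (forall i j, h i j = h j i) ->
  (forall i j, \sum_l dK l l i j + 2 * \sum_m c m * K m i j =
     h i j + 2 * \sum_l \sum_m K l i m * K m j l) ->
  forall A B : 'I_(n + n),
  \sum_L (blockdG dK L L A B - blockdG dK B L A L) +
  \sum_L \sum_M (blockG K L L M * blockG K M A B - blockG K L B M * blockG K M A L) =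
  block_mx (- \matrix_(i, j) h i j) 0 0 (- \matrix_(i, j) h i j) A B.
Proof.
move=> Ks Kc dKh dKs hs Kid A B.
have ddK i j : \sum_l dK i l j l = h i j.
  by rewrite -dKh; apply: eq_bigr => l _; rewrite dKs.
have cK i j : \sum_l \sum_m K l l m * K m i j = \sum_m c m * K m i j.
  by rewrite exchange_big; apply: eq_bigr => m _; rewrite -mulr_suml Kc.
have KK i j : \sum_l \sum_m K l j m * K m i l = \sum_l \sum_m K l i m * K m j l.
  rewrite exchange_big; apply: eq_bigr => l _; apply: eq_bigr => m _.
  by rewrite mulrC (Ks l) (Ks m) [K m l j]Ks.
case: (split_ordP A) => i ->; case: (split_ordP B) => j ->.
- rewrite block_mxEul !mxE.
  have -> : \sum_L (blockdG dK L L (lshift n i) (lshift n j) -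
      blockdG dK (lshift n j) L (lshift n i) L) = \sum_l dK l l i j - 2 * h j i.
    rewrite sumrB !big_split_ord /= -!ddK mulr_natl mulr2n; congr (_ - (_ + _)).
    + rewrite [X in _ + X]big1 ?addr0 => [|m _]; last by rewrite blockdGE.
      by apply: eq_bigr => l _; rewrite blockdGE blockGE.
    + by apply: eq_bigr => l _; rewrite blockdGE blockGE.
    + by apply: eq_bigr => l _; rewrite blockdGE blockGE.
  have -> : \sum_L \sum_M (blockG K L L M * blockG K M (lshift n i) (lshift n j) -
      blockG K L (lshift n j) M * blockG K M (lshift n i) L) =
      2 * \sum_m c m * K m i j - 2 * \sum_l \sum_m K l i m * K m j l.
    rewrite -(cK i j) -(KK i j) !mulr_natl !mulr2n opprD addrACA -!sumrB.
    rewrite big_split_ord /=; congr (_ + _); apply: eq_bigr => l _;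
      rewrite big_split_ord /= -sumrB.
    + rewrite [X in _ + X]big1 ?addr0 => [|m _]; last by rewrite !blockGE; ring.
      by apply: eq_bigr => m _; rewrite !blockGE.
    + rewrite -big_split /=; apply: eq_bigr => m _; rewrite !blockGE; ring.
  have := Kid i j; rewrite (hs i j); lra.
- rewrite block_mxEur mxE !big1 ?addr0 // => L _.
    apply: big1 => M _; case: (split_ordP L) => l ->; case: (split_ordP M) => m ->;
      rewrite !blockGE; ring.
  by case: (split_ordP L) => l ->; rewrite !blockdGE ?blockGE subr0.
- rewrite block_mxEdl mxE !big1 ?addr0 // => L _.
    apply: big1 => M _; case: (split_ordP L) => l ->; case: (split_ordP M) => m ->;
      rewrite !blockGE; ring.
  by case: (split_ordP L) => l ->; rewrite !blockdGE !blockGE ?subr0.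
- rewrite block_mxEdr !mxE.
  have -> : \sum_L (blockdG dK L L (rshift n i) (rshift n j) -
      blockdG dK (rshift n j) L (rshift n i) L) = - \sum_l dK l l i j.
    rewrite sumrB !big_split_ord /= -sumrN.
    rewrite [X in _ + X - _]big1 ?addr0 => [|m _]; last by rewrite blockdGE.
    rewrite [X in _ - (X + _)]big1 ?add0r => [|m _]; last by rewrite blockdGE.
    rewrite [X in _ - X]big1 ?subr0 => [|m _]; last by rewrite blockdGE.
    by apply: eq_bigr => l _; rewrite blockdGE blockGE.
  have -> : \sum_L \sum_M (blockG K L L M * blockG K M (rshift n i) (rshift n j) -
      blockG K L (rshift n j) M * blockG K M (rshift n i) L) =
      - (2 * \sum_m c m * K m i j) + 2 * \sum_l \sum_m K l i m * K m j l.
    rewrite -(cK i j) -(KK i j) !mulr_natl !mulr2n opprD addrACA addrC.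
    rewrite -!sumrB big_split_ord /=; congr (_ + _); apply: eq_bigr => l _;
      rewrite big_split_ord /= -sumrB.
    + rewrite -big_split /=; apply: eq_bigr => m _; rewrite !blockGE; ring.
    + rewrite -big_split /=; apply: eq_bigr => m _; rewrite !blockGE; ring.
  have := Kid i j; lra.
Qed.
End BlockTables.

(** * Ricci curvature of a tube metric *)

Section RicciHessian.
Context {R : realType} {n : nat} (P : 'rV[R]_n -> 'M[R]_n) (hP : hessian_metric P).
Local Notation lv := (@lsubmx R 1 n n).
Local Notation e_ := (basis_vec R).

(** P describes the metric on R^n; this is the invariant Kaehler metric it
    induces on the tube R^n + i R^n. *)
Definition tube_metric (z : 'rV[R]_(n + n)) : 'M[R]_(n + n) :=
  block_mx (P (lv z)) 0 0 (P (lv z)).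

Lemma eq_pderiv k (f g : 'rV[R]_k -> R) j z : (forall y, f y = g y) ->
  pderiv j f z = pderiv j g z.
Proof. by move=> fg; have -> : f = g by apply/funext. Qed.

Lemma pderiv_lsubmx_split k (F : 'rV[R]_n -> R) z : pderiv k (fun a => F (lv a)) z =
  (match fintype.split k with inl k => pderiv k F (lv z) | inr _ => 0 end).
Proof.
case: (split_ordP k) => k' ->; rewrite ?split_lshift ?split_rshift.
  exact: pderiv_lsubmx.
exact: pderiv_lsubmx0.
Qed.

Lemma pderiv_tube k i j z : pderiv k (fun a => tube_metric a i j) z =
  blockD (fun k i j => pderiv k (fun y => P y i j) (lv z)) k i j.
Proof.
case: (split_ordP i) => i' ->; case: (split_ordP j) => j' ->.
- rewrite (eq_pderiv _ _ (g := fun a => P (lv a) i' j')) => [|y]; last exact: block_mxEul.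
  by rewrite (pderiv_lsubmx_split k (fun y => P y i' j')) /blockD !(split_lshift, split_rshift).
- rewrite (eq_pderiv _ _ (g := fun=> 0)) => [|y]; last by rewrite block_mxEur mxE.
  by rewrite pderiv_cst; case: (split_ordP k) => k' ->; rewrite ?blockDE ?blockD0.
- rewrite (eq_pderiv _ _ (g := fun=> 0)) => [|y]; last by rewrite block_mxEdl mxE.
  by rewrite pderiv_cst; case: (split_ordP k) => k' ->; rewrite ?blockDE ?blockD0.
- rewrite (eq_pderiv _ _ (g := fun a => P (lv a) i' j')) => [|y]; last exact: block_mxEdr.
  by rewrite (pderiv_lsubmx_split k (fun y => P y i' j')) /blockD !(split_lshift, split_rshift).
Qed.

Lemma hm_unit x : P x \in unitmx.
Proof. by rewrite unitmxE unitfE posdef_det_neq0 //; exact: (hm_pos hP). Qed.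

Lemma pderiv_sym12 x i j k :
  pderiv i (fun y => P y j k) x = pderiv j (fun y => P y i k) x.
Proof.
rewrite (eq_pderiv _ _ (g := fun y => P y k j)) => [|y]; last exact: (hm_sym hP).
rewrite (hm_codazzi hP); apply: eq_pderiv => y; exact: (hm_sym hP).
Qed.

Lemma pderiv_sym23 x i j k :
  pderiv i (fun y => P y j k) x = pderiv i (fun y => P y k j) x.
Proof. by apply: eq_pderiv => y; exact: (hm_sym hP). Qed.

Lemma christoffel_tube l i j z : christoffel tube_metric l i j z =
  blockG (fun l i j => conn P i (lv z) l j) l i j.
Proof.
rewrite /christoffel (invmx_block_diag2 (hm_unit _) (hm_unit _)).
under eq_bigr => m _ do rewrite !pderiv_tube.
rewrite christoffel_table; last 2 first.
- by move=> a b c; exact: pderiv_sym12.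
- by move=> a b c; exact: pderiv_sym23.
by rewrite /blockG; case: (fintype.split l) => l'; case: (fintype.split i) => i';
  case: (fintype.split j) => j' //; rewrite connE.
Qed.

Lemma pderiv_christoffel_tube k l i j z :
  pderiv k (christoffel tube_metric l i j) z =
  blockdG (fun k l i j => pderiv k (fun y => conn P i y l j) (lv z)) k l i j.
Proof.
have dcN a b c : differentiable (fun y => conn P b y a c) (lv z).
  exact: differentiable_conn hP _ _ _ _.
rewrite (eq_pderiv _ _ (g := fun z => blockG (fun l i j => conn P i (lv z) l j) l i j));
  last by move=> y; exact: christoffel_tube.
have aux := fun F => pderiv_lsubmx_split k F z.
have aux0 : pderiv k (fun=> 0 : R) z = 0 by exact: pderiv_cst.
rewrite /blockdG /blockG.
case: (fintype.split l) => l'; case: (fintype.split i) => i';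
  case: (fintype.split j) => j';
  rewrite ?aux0 ?(aux (fun y => conn P i' y l' j')) ?(aux (fun y => - conn P i' y l' j'));
  case: (fintype.split k) => k' //.
by rewrite /pderiv -deriveN //; exact: diff_derivable.
Qed.

Lemma hessian_sym (f : 'rV[R]_n -> R) x i j : smooth_on setT f ->
  pderiv i (pderiv j f) x = pderiv j (pderiv i f) x.
Proof. by move=> fs; apply: schwarz; exact: (smooth_onP _ _).1 fs 2%N. Qed.

(** In Kaehler terms: the Ricci form is - i d dbar log det P. *)
Lemma ricci_tube z : ricci tube_metric z =
  block_mx (- hessian (half_log_det P) (lv z)) 0 0 (- hessian (half_log_det P) (lv z)).
Proof.
apply/matrixP => A B; rewrite mxE.
under eq_bigr => L _ do rewrite !pderiv_christoffel_tube.
under [X in _ + X]eq_bigr => L _ do under eq_bigr => M _ do rewrite !christoffel_tube.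
apply: (@ricci_table R n (fun l i j => conn P i (lv z) l j)
  (fun k l i j => pderiv k (fun y => conn P i y l j) (lv z))
  (fun m => pderiv m (half_log_det P) (lv z))
  (fun i j => pderiv i (pderiv j (half_log_det P)) (lv z))).
- by move=> l i j; exact: conn_sym.
- by move=> m; exact: conn_trace.
- move=> j i; rewrite /pderiv -derive_bigsum => [|l]; last exact: differentiable_conn.
  by apply: eq_pderiv => y; exact: conn_trace.
- by move=> k l i j; apply: eq_pderiv => y; exact: conn_sym.
- by move=> i j; apply: hessian_sym; exact: smooth_half_log_det.
- by move=> i j; exact: conn_identity.
Qed.

End RicciHessian.

(** * Mean curvature of the torus orbits in a tube *)

Section RowVectors.
Context {R : realType}.

Lemma Ck_rV (V : normedModType R) m k (U : set V) (f : V -> 'rV[R]_m) : open U ->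
  (forall j, Ck k U (fun z => f z 0 j)) -> Ck k U f.
Proof.
move=> oU fC.
have : Ck k U (fun z => \sum_j f z 0 j *: basis_vec R j).
  by apply: Ck_sum => // j _; apply: CkS => //; exact: Ck_cst.
by apply: Ck_eq => // z _; rewrite -row_sum_delta.
Qed.

Lemma Ck_coord m k (U : set 'rV[R]_m) j : open U -> Ck k U (fun z : 'rV[R]_m => z 0 j).
Proof.
move=> oU; have dc z : differentiable (fun z : 'rV[R]_m => z 0 j) z.
  exact: differentiable_coord.
case: k => [|k]; split=> // v.
apply: (Ck_eq oU _ (Ck_cst k U (v 0 j))) => z _.
have di : derivable id z v by exact: derivable_id.
have := derive_mx di; rewrite derive_id => /rowP/(_ j); rewrite mxE => ->.
by [].
Qed.

Lemma derive_rowE (V : normedModType R) m (f : V -> 'rV[R]_m) z v j :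
  differentiable f z -> 'D_v (fun y => f y 0 j) z = 'D_v f z 0 j.
Proof.
by move=> df; rewrite derive_mx ?mxE //; exact: diff_derivable.
Qed.

Lemma jacobianE k m (f : 'rV[R]_k -> 'rV[R]_m) z a l : differentiable f z ->
  jacobian f z a l = pderiv a (fun u => f u 0 l) z.
Proof.
by move=> df; rewrite /pderiv derive_rowE // deriveEjacobian // -rowE [RHS]mxE.
Qed.

Lemma pderiv_coord m (z : 'rV[R]_m) a l : pderiv a (fun u : 'rV[R]_m => u 0 l) z = (a == l)%:R.
Proof.
rewrite /pderiv (derive_rowE (f := id)); last by [].
by rewrite derive_id mxE eqxx /= eq_sym.
Qed.

End RowVectors.

Section MeanCurvature.
Context {R : realType} {n : nat} (P : 'rV[R]_n -> 'M[R]_n) (hP : hessian_metric P).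

(** By total symmetry of d_k P_ij, contracting the two lower indices of the
    Christoffel symbols gives the gradient of the logarithmic volume density. *)
Lemma conn_contraction x l :
  \sum_a \sum_b invmx (P x) a b * conn P a x l b =
  \sum_m invmx (P x) l m * pderiv m (half_log_det P) x.
Proof.
set Q := invmx (P x).
pose T m b a := pderiv m (fun y => P y b a) x.
transitivity (\sum_a \sum_b \sum_m Q a b * (2^-1 * (Q l m * T m b a))).
  apply: eq_bigr => a _; apply: eq_bigr => b _; rewrite connE -!mulr_sumr.
  congr (_ * (_ * _)); apply: eq_bigr => m _.
  rewrite -/Q (pderiv_sym12 hP) (pderiv_sym23 hP) -/(T m b a).
  by rewrite /T (pderiv_sym23 hP).
transitivity (\sum_a \sum_m \sum_b Q a b * (2^-1 * (Q l m * T m b a))).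
  by apply: eq_bigr => a _; exact: exchange_big.
rewrite exchange_big; apply: eq_bigr => m _ /=.
rewrite -(conn_trace hP) mulr_sumr; apply: eq_bigr => a _.
rewrite (conn_sym hP) connE !mulr_sumr; apply: eq_bigr => b _.
rewrite -/Q -/(T m b a); ring.
Qed.

Let f (x : 'rV[R]_n) := fun u : 'rV[R]_n => row_mx x u.

Let Ck_f k (x : 'rV[R]_n) : Ck k setT (f x).
Proof.
have oT := @openT 'rV[R]_n; apply: Ck_rV => // j.
case: (split_ordP j) => i ->.
  by apply: (Ck_eq oT _ (Ck_cst k setT (x 0 i))) => u _; rewrite /f row_mxEl.
by apply: (Ck_eq oT _ (Ck_coord k i oT)) => u _; rewrite /f row_mxEr.
Qed.

Lemma differentiable_tube_orbit (x u : 'rV[R]_n) : differentiable (f x) u.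
Proof. exact: Ck_diff (Ck_f 0 x) _. Qed.

Lemma jacobian_tube_orbit (x u : 'rV[R]_n) :
  jacobian (f x) u = row_mx 0 1%:M :> 'M[R]_(n, n + n).
Proof.
apply/matrixP => a l; rewrite jacobianE; last exact: differentiable_tube_orbit.
case: (split_ordP l) => i ->.
  rewrite row_mxEl mxE (eq_pderiv _ _ (g := fun=> x 0 i)) ?pderiv_cst // => y.
  by rewrite /f row_mxEl.
rewrite row_mxEr mxE (eq_pderiv _ _ (g := fun u => u 0 i)) ?pderiv_coord // => y.
by rewrite /f row_mxEr.
Qed.

(** The mean curvature vector of the orbit over x is minus the gradient, with
    respect to P, of the logarithmic volume density at x. *)
Lemma mean_curvature_tube (x y : 'rV[R]_n) :
  critical_point (half_log_det P) x ->
  mean_curvature (tube_metric P) (f x) y = 0.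
Proof.
move=> cx; rewrite /mean_curvature jacobian_tube_orbit.
set T : 'M[R]_(n, n + n) := row_mx 0 1%:M.
set h := T *m tube_metric P (f x y) *m T^T.
have hE : h = P x.
  rewrite /h /T /tube_metric /f row_mxKl tr_row_mx mul_row_block.
  by rewrite !mul0mx !add0r !mul1mx mul_row_col !trmx0 mulmx0 add0r trmx1 mulmx1.
have Tl a i : T a (lshift n i) = 0 by rewrite /T row_mxEl mxE.
have Tr a i : T a (rshift n i) = (a == i)%:R by rewrite /T row_mxEr mxE.
set w : 'rV[R]_(n + n) := \sum_a _.
suff -> : w = 0 by rewrite !mul0mx subr0.
apply/rowP => l; rewrite /w summxE mxE.
under eq_bigr => a _ do rewrite summxE.
have nablaE a b : pderiv a (pderiv b (fun u => f x u 0 l)) y +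
    \sum_i \sum_j christoffel (tube_metric P) l i j (f x y) * T a i * T b j =
    blockG (fun l i j => conn P i x l j) l (rshift n a) (rshift n b).
  have -> : pderiv a (pderiv b (fun u => f x u 0 l)) y = 0.
    rewrite (eq_pderiv _ _ (g := fun=> T b l)) ?pderiv_cst // => u.
    by rewrite -jacobianE ?jacobian_tube_orbit //; exact: differentiable_tube_orbit.
  rewrite add0r (bigD1 (rshift n a)) //= [X in _ + X]big1 ?addr0 => [|i ia]; last first.
    rewrite big1 // => j _; case: (split_ordP i) ia => i' -> ia.
      by rewrite Tl mulr0 mul0r.
    rewrite Tr (_ : (a == i') = false) ?mulr0 ?mul0r //.
    by apply: contraNF ia => /eqP ->.
  rewrite (bigD1 (rshift n b)) //= [X in _ + X]big1 ?addr0 => [|j jb]; last first.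
    case: (split_ordP j) jb => j' -> jb; first by rewrite Tl mulr0.
    rewrite [T b _]Tr (_ : (b == j') = false) ?mulr0 //.
    by apply: contraNF jb => /eqP ->.
  rewrite [T a _]Tr [T b _]Tr !eqxx !mulr1.
  rewrite (christoffel_tube hP).
  by rewrite /f row_mxKl.
under eq_bigr => a _ do under eq_bigr => b _ do rewrite mxE mxE nablaE hE.
case: (split_ordP l) => i ->.
  under eq_bigr => a _ do under eq_bigr => b _ do rewrite blockGE mulrN.
  under eq_bigr => a _ do rewrite sumrN.
  rewrite sumrN conn_contraction big1 ?oppr0 // => m _.
  by have [_ E] := cx (basis_vec R m); rewrite /pderiv E mulr0.
by rewrite big1 // => a _; rewrite big1 // => b _; rewrite blockGE mulr0.
Qed.

End MeanCurvature.

(** * Volume density and convexity *)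

Section VolumeConvexity.
Context {R : realType} {n : nat}.

Lemma posdef_block2 (A : 'M[R]_n) : posdef (block_mx A 0 0 A) <-> posdef A.
Proof.
have E (u v : 'rV[R]_n) : (row_mx u v *m block_mx A 0 0 A *m (row_mx u v)^T) 0 0 =
    (u *m A *m u^T) 0 0 + (v *m A *m v^T) 0 0.
  rewrite tr_row_mx mul_row_block !mulmx0 addr0 add0r mul_row_col.
  exact: mxE.
split=> pA v v0.
  have := pA (row_mx v 0); rewrite E mul0mx mul0mx [_ 0 0 in X in _ + X]mxE addr0; apply.
  by rewrite row_mx_eq0 (negbTE v0).
rewrite -(hsubmxK v) E; set a := lsubmx v; set b := rsubmx v.
have ge0 (u : 'rV[R]_n) : 0 <= (u *m A *m u^T) 0 0.
  have [->|u0] := eqVneq u 0; last by apply: ltW; exact: pA.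
  by rewrite mul0mx mul0mx mxE.
have [a0|a0] := eqVneq a 0; last by apply: ltr_pwDl => //; exact: pA.
have [b0|b0] := eqVneq b 0; last by apply: ltr_wpDl => //; exact: pA.
by move: v0; rewrite -(hsubmxK v) -/a -/b a0 b0 row_mx0 eqxx.
Qed.

Lemma smooth_onN (f : 'rV[R]_n -> R) : smooth_on setT f ->
  smooth_on setT (fun x => - f x).
Proof.
move=> /smooth_onP fs; apply/smooth_onP => k; have oT := @openT 'rV[R]_n.
apply: (Ck_eq oT _ (CkM oT (Ck_cst k setT (-1 : R)) (fs k))) => x _.
by rewrite mulN1r.
Qed.

Lemma smooth_addl (c : R) (f : 'rV[R]_n -> R) : smooth_on setT f ->
  smooth_on setT (fun x => c + f x).
Proof.
move=> /smooth_onP fs; apply/smooth_onP => k; have oT := @openT 'rV[R]_n.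
exact: (CkD oT (Ck_cst k setT c) (fs k)).
Qed.

Lemma pderivN (f : 'rV[R]_n -> R) j x : differentiable f x ->
  pderiv j (fun y => - f y) x = - pderiv j f x.
Proof. by move=> df; apply: (@deriveN _ _ _ f); exact: diff_derivable. Qed.

Lemma half_mulr2n (a : R) : a = 2^-1 * (a *+ 2).
Proof. by rewrite -[a *+ 2]mulr_natl mulrA mulVf ?mul1r // pnatr_eq0. Qed.

Lemma hessianE (f : 'rV[R]_n -> R) x i j :
  hessian f x i j = pderiv i (pderiv j f) x.
Proof. exact: mxE. Qed.

Lemma hessianN (f : 'rV[R]_n -> R) x : smooth_on setT f ->
  hessian (fun x => - f x) x = - hessian f x.
Proof.
move=> fs; apply/matrixP => i j; apply: etrans (hessianE _ _ _ _) _.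
rewrite [RHS]mxE; apply: etrans _ (esym (congr1 -%R (hessianE _ _ _ _))).
rewrite -pderivN; last exact: smooth_differentiable (smooth_pderiv j fs) x.
by apply: eq_pderiv => y; apply: pderivN; exact: smooth_differentiable fs y.
Qed.

Lemma hessian_addl (c : R) (f : 'rV[R]_n -> R) x : smooth_on setT f ->
  hessian (fun x => c + f x) x = hessian f x.
Proof.
move=> fs; apply/matrixP => i j; apply: etrans (hessianE _ _ _ _) _.
apply: etrans _ (esym (hessianE _ _ _ _)); apply: eq_pderiv => y.
have df : derivable f y (basis_vec R j).
  exact: diff_derivable (smooth_differentiable fs y).
have := deriveD (derivable_cst c y (basis_vec R j)) df.
by rewrite derive_cst add0r.
Qed.

Lemma eq_strictly_convex (f g : 'rV[R]_n -> R) : (forall x, f x = g x) ->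
  strictly_convex f -> strictly_convex g.
Proof. by move=> /funext ->. Qed.

Lemma strictly_convex_addl (c : R) (f : 'rV[R]_n -> R) :
  strictly_convex (fun x => c + f x) <-> strictly_convex f.
Proof.
have H a g : strictly_convex g -> strictly_convex (fun x : 'rV[R]_n => a + g x).
  move=> [gs gp]; split; first exact: smooth_addl.
  by move=> x; rewrite hessian_addl.
split=> [cf|]; last exact: H.
apply: eq_strictly_convex (H (- c) _ cf) => x; exact: addKr.
Qed.

Variables (P : 'rV[R]_n -> 'M[R]_n).
Hypothesis hP : hessian_metric P.
Let f := half_log_det P.
Let fs : smooth_on setT f. Proof. exact: smooth_half_log_det. Qed.

Lemma ricci_neg_tube : (forall z, negdef (ricci (tube_metric P) z)) <-> strictly_convex f.
Proof.
rewrite /negdef; split=> [rn|[_ cf] z].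
  split=> // x; have := rn (row_mx x 0).
  by rewrite ricci_tube // opp_block_mx oppr0 opprK posdef_block2 row_mxKl.
by rewrite ricci_tube // opp_block_mx oppr0 opprK posdef_block2.
Qed.

Lemma ricci_pos_tube : (forall z, posdef (ricci (tube_metric P) z)) <->
  strictly_convex (fun x => - f x).
Proof.
split=> [rn|[_ cf] z].
  split=> [|x]; first exact: smooth_onN.
  rewrite hessianN //; have := rn (row_mx x 0).
  by rewrite ricci_tube // posdef_block2 row_mxKl.
by rewrite ricci_tube // posdef_block2 -hessianN.
Qed.

Variables (c : R) (Vol : 'rV[R]_n -> R).
Hypotheses (c0 : 0 < c) (VolE : forall x, Vol x = c * Num.sqrt (\det (P x))).

Lemma ln_VolE x : ln (Vol x) = ln c + f x.
Proof.
have d0 := posdef_det_gt0 (hm_pos hP x).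
rewrite VolE lnM ?posrE ?sqrtr_gt0 //; congr (_ + _).
rewrite /f /half_log_det -[in RHS](sqr_sqrtr (ltW d0)) lnXn ?sqrtr_gt0 //.
exact: half_mulr2n.
Qed.

Lemma Vol_gt0 x : 0 < Vol x.
Proof. by rewrite VolE mulr_gt0 // sqrtr_gt0; exact: posdef_det_gt0 (hm_pos hP x). Qed.

Lemma strictly_convex_ln_Vol :
  strictly_convex (fun x => ln (Vol x)) <-> strictly_convex f.
Proof.
rewrite -[X in _ <-> X](strictly_convex_addl (ln c)).
by rewrite (_ : (fun x => ln (Vol x)) = (fun x => ln c + f x)) //; apply/funext => x; exact: ln_VolE.
Qed.

Lemma strictly_convex_Nln_Vol :
  strictly_convex (fun x => - ln (Vol x)) <-> strictly_convex (fun x => - f x).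
Proof.
rewrite -[X in _ <-> X](strictly_convex_addl (- ln c)).
rewrite (_ : (fun x => - ln (Vol x)) = (fun x => - ln c + - f x)) //.
by apply/funext => x; rewrite ln_VolE opprD.
Qed.

Lemma strictly_convex_Vol : strictly_convex f -> strictly_convex Vol.
Proof.
move=> cf; apply: eq_strictly_convex (strictly_convex_expR (strictly_convex_ln_Vol.2 cf)) => x.
by rewrite lnK // posrE Vol_gt0.
Qed.

Lemma strictly_convex_invVol : strictly_convex (fun x => - f x) ->
  strictly_convex (fun x => (Vol x)^-1).
Proof.
move=> cf; apply: eq_strictly_convex (strictly_convex_expR (strictly_convex_Nln_Vol.2 cf)) => x.
by rewrite expRN lnK // posrE Vol_gt0.
Qed.

Lemma Vol_expE : Vol = (fun x => expR (ln c + f x)).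
Proof. by apply/funext => x; rewrite -ln_VolE lnK // posrE Vol_gt0. Qed.

Lemma smooth_Vol : smooth_on setT Vol.
Proof. by rewrite Vol_expE; apply: smooth_expR; [exact: openT|exact: smooth_addl]. Qed.

Lemma critical_Vol x : critical_point Vol x <-> critical_point f x.
Proof.
have df : differentiable f x by exact: smooth_differentiable fs x.
have dcf : differentiable (fun x => ln c + f x) x.
  by apply: smooth_differentiable; exact: smooth_addl.
have dV : differentiable Vol x by exact: smooth_differentiable smooth_Vol x.
have DE v : 'D_v Vol x = expR (ln c + f x) * 'D_v f x.
  rewrite [in LHS]Vol_expE derive_expR_comp //; congr (_ * _).
  have := deriveD (derivable_cst (ln c) x v) (diff_derivable (v := v) df).
  by rewrite derive_cst add0r.
rewrite (critical_pointP dV) (critical_pointP df); split=> H v.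
  by have /eqP := H v; rewrite DE mulf_eq0 gt_eqF ?expR_gt0 //= => /eqP.
by rewrite DE H mulr0.
Qed.

Lemma critical_oppr (g : 'rV[R]_n -> R) x : differentiable g x ->
  critical_point g x <-> critical_point (fun x => - g x) x.
Proof.
move=> dg; have dNg : differentiable (fun x => - g x) x by exact: differentiableN.
rewrite (critical_pointP dg) (critical_pointP dNg).
have DE v : 'D_v (fun x => - g x) x = - 'D_v g x.
  by apply: (@deriveN _ _ _ g); exact: diff_derivable.
split=> H v; first by rewrite DE H oppr0.
by have /eqP := H v; rewrite DE oppr_eq0 => /eqP.
Qed.

Hypothesis Vol_proper : forall e, 0 < e -> exists K : R, forall x, K <= `|x| -> Vol x < e.

(** Vol is positive, continuous and tends to 0 at infinity. *)
Lemma Vol_max : exists x0, forall x, Vol x <= Vol x0.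
Proof.
have [K HK] := Vol_proper (Vol_gt0 0).
pose A : set 'rV[R]_n := [set x | `|x| <= K].
have cA : compact A.
  apply: bounded_closed_compact.
    by exists K; split; [exact: num_real|move=> M KM x /= /le_trans; apply; exact: ltW].
  apply: (@closed_comp _ _ (fun x : 'rV[R]_n => `|x|) [set y | y <= K]).
    by move=> x _; exact: norm_continuous.
  exact: closed_le.
have A0 : A 0.
  rewrite /A /= leNgt; apply/negP => K0.
  by have := HK 0 (ltW K0); rewrite ltxx.
have [||c' cA' Hc] := EVT_max_rV (f := Vol) _ cA; first by exists 0.
  apply: continuous_subspaceT => x; apply: differentiable_continuous.
  exact: smooth_differentiable smooth_Vol x.
exists c' => x; have [xK|/ltW Kx] := leP `|x| K; first by apply: Hc; rewrite inE.
apply: le_trans (ltW (HK x Kx)) _; apply: Hc; by rewrite inE.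
Qed.

(** A maximum is a critical point, whereas a strictly convex function is
    larger at every point other than its critical point. *)
Lemma Vol_not_convex : (0 < n)%N -> ~ strictly_convex Vol.
Proof.
move=> n0 cV; have [x0 Vmax] := Vol_max.
have cx : critical_point Vol x0.
  apply: critical_point_max => // y; exact: smooth_differentiable smooth_Vol y.
pose e : 'rV[R]_n := basis_vec R (Ordinal n0).
have e0 : e != 0.
  by apply/eqP => /rowP/(_ (Ordinal n0))/eqP; rewrite !mxE !eqxx oner_eq0.
have := strictly_convex_critical_lt cV cx (x := x0 + e).
rewrite -subr_eq0 addrC addKr => /(_ e0).
by rewrite ltNge Vmax.
Qed.

Lemma Vol_unique_max : strictly_convex (fun x => - f x) ->
  exists x0, [/\ critical_point Vol x0, forall x, critical_point Vol x -> x = x0,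
    forall x, Vol x <= Vol x0 & critical_point f x0].
Proof.
move=> cf; have [x0 Vmax] := Vol_max; exists x0.
have cx : critical_point Vol x0.
  apply: critical_point_max => // y; exact: smooth_differentiable smooth_Vol y.
split=> //; last exact/critical_Vol.
have df y : differentiable f y by exact: smooth_differentiable fs y.
have H y : critical_point Vol y -> critical_point (fun x => - f x) y.
  by move=> /critical_Vol; rewrite critical_oppr.
move=> x cx'; apply/eqP/negPn/negP => xx0.
have := strictly_convex_critical_lt cf (H _ cx) xx0.
rewrite eq_sym in xx0.
have := strictly_convex_critical_lt cf (H _ cx') xx0.
by move=> /lt_trans h /h; rewrite ltxx.
Qed.

End VolumeConvexity.

(** * Monotone maps with bounded preimages *)

Section Properness.
Context {R : realType} {n : nat}.

Lemma entry_le_norm (u : 'rV[R]_n) i : `|u 0 i| <= `|u|.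
Proof.
rewrite [leRHS]/Num.Def.normr /= mx_normrE.
exact: (le_bigmax _ (fun ij : 'I_1 * 'I_n => `|u ij.1 ij.2|) (0, i)).
Qed.

(** The quadratic form of A0 has a positive minimum on the unit sphere, and
    moving each coefficient by eta changes its values there by at most n^2 eta. *)
Lemma posdef_uniform (A0 : 'M[R]_n) : (0 < n)%N -> posdef A0 ->
  exists c eta : R, [/\ 0 < c, 0 < eta & forall A : 'M[R]_n,
    (forall i j, `|A0 i j - A i j| < eta) ->
    forall u : 'rV[R]_n, `|u| = 1 -> c <= (u *m A *m u^T) 0 0].
Proof.
move=> n0 pA.
pose S : set 'rV[R]_n := [set u | `|u| = 1].
pose q (A : 'M[R]_n) (u : 'rV[R]_n) := (u *m A *m u^T) 0 0.
have cS : compact S.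
  apply: bounded_closed_compact.
    by exists 1; split; [exact: num_real|move=> M KM x /= ->; exact: ltW].
  apply: (@closed_comp _ _ (fun x : 'rV[R]_n => `|x|) [set y | y = 1]).
    by move=> x _; exact: norm_continuous.
  exact: closed_eq.
pose e : 'rV[R]_n := const_mx 1.
have S0 : S !=set0.
  exists e; rewrite /S /= [LHS]/Num.Def.normr /= mx_normrE.
  apply/eqP; rewrite eq_le; apply/andP; split.
    by apply: bigmax_le => // i _; rewrite mxE normr1.
  have := le_bigmax 0 (fun ij : 'I_1 * 'I_n => `|e ij.1 ij.2|) (0, Ordinal n0).
  by rewrite /= mxE normr1.
have oT := @openT 'rV[R]_n.
have Ckq : Ck 0 setT (q A0).
  have : Ck 0 setT (fun u : 'rV[R]_n => \sum_i \sum_j u 0 i * u 0 j * A0 i j).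
    apply: Ck_sum => // i _; apply: Ck_sum => // j _.
    apply: (CkM oT _ (Ck_cst 0 setT (A0 i j))).
    exact: (CkM oT (Ck_coord 0 i oT) (Ck_coord 0 j oT)).
  by apply: (Ck_eq oT) => u _; rewrite /q quad_formE.
have dq : continuous (q A0).
  by move=> u; apply: differentiable_continuous; exact: Ck_diff Ckq _.
have [|u0 u0S qmin] := EVT_min_rV S0 cS (f := q A0).
  exact: continuous_subspaceT.
have m0 : 0 < q A0 u0.
  apply: pA; apply/eqP => u00; move: u0S; rewrite inE /S /= u00 normr0 => /esym/eqP.
  by rewrite oner_eq0.
(* n^2 coefficients, each off by less than m/(2 n^2), change the values on the
   unit sphere by at most m/2. *)
pose m := q A0 u0; pose N : R := n%:R ^+ 2.
have N0 : 0 < N by rewrite exprn_gt0 // ltr0n.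
exists (m / 2), (m / 2 / N); split; [by rewrite divr_gt0|by rewrite !divr_gt0|].
move=> A HA u u1.
have h1 : m <= q A0 u by apply: qmin; rewrite inE.
have h2 : q A0 u - q A u <= m / 2.
  rewrite /q !quad_formE -sumrB.
  apply: (@le_trans _ _ (\sum_(i < n) \sum_(j < n) (m / 2 / N))).
    apply: ler_sum => i _; rewrite -sumrB; apply: ler_sum => j _.
    rewrite -mulrBr; apply: le_trans (ler_norm _) _; rewrite normrM.
    rewrite -[leRHS]mul1r; apply: ler_pM => //; last exact: ltW (HA i j).
    rewrite normrM -[leRHS]mul1r; apply: ler_pM => //; rewrite -u1; exact: entry_le_norm.
  rewrite !sumr_const !card_ord -[X in X <= _]mulr_natr -[X in X * _ <= _]mulr_natr.
  rewrite -[X in X <= _]mulrA -[n%:R * n%:R]/N divfK //.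
  by rewrite gt_eqF.
rewrite -/(q A u); rewrite -/m in m0 h1; lra.
Qed.

Variables (Phi : 'rV[R]_n -> 'rV[R]_n) (P : 'rV[R]_n -> 'M[R]_n).
Hypothesis dPhi : forall x, differentiable Phi x.
Hypothesis PE : forall x w (v : 'rV[R]_n), ('D_w Phi x *m v^T) 0 0 = - (v *m P x *m w^T) 0 0.
Hypothesis pP : forall x, posdef (P x).

Let psi (x u : 'rV[R]_n) (s : R) : R := (Phi (x + s *: u) *m u^T) 0 0.

Let dpsi (x u : 'rV[R]_n) (s : R) : is_derive s 1 (psi x u) (- (u *m P (x + s *: u) *m u^T) 0 0).
Proof.
rewrite -PE.
have -> : psi x u = \sum_j (fun s => u 0 j * Phi (x + s *: u) 0 j).
  apply/funext => t; rewrite /psi mxE fct_sumE; apply: eq_bigr => j _.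
  by rewrite mxE mulrC.
rewrite mxE; apply: (@is_derive_eq _ _ _ _ _ _ _ (\sum_j u 0 j * 'D_u Phi (x + s *: u) 0 j)).
  apply: is_derive_sum => j; apply: is_deriveZ.
  have dj : differentiable (fun y => Phi y 0 j) (x + s *: u).
    exact: (@differentiable_comp _ _ _ _ Phi (fun y : 'rV[R]_n => y 0 j) _ (dPhi _)
      (differentiable_coord _ _ _)).
  by rewrite -derive_rowE //; exact: (is_derive_line dj).
by apply: eq_bigr => j _; rewrite [u^T _ _]mxE mulrC.
Qed.

Let psi_cont x u (A : set R) : {within A, continuous (psi x u)}.
Proof.
apply: continuous_subspaceT => s; apply: differentiable_continuous.
by apply/derivable1_diffP; have [] := dpsi x u s.
Qed.

Lemma psi_decr x u (a b c : R) : a <= b ->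
  (forall s, a <= s <= b -> c <= (u *m P (x + s *: u) *m u^T) 0 0) ->
  c * (b - a) <= psi x u a - psi x u b.
Proof.
rewrite le_eqVlt => /predU1P[->|ab] H; first by rewrite !subrr mulr0.
have [s sI E] := MVT ab (fun s _ => dpsi x u s) (@psi_cont x u _).
rewrite -[psi x u a - _]opprB E -mulNr opprK ler_pM2r ?subr_gt0 // H //.
by move: sI; rewrite in_itv /= => /andP[/ltW -> /ltW ->].
Qed.

(** Along the segment from x to y the component of Phi in the direction of the
    segment decreases at rate at least c up to distance r, and does not
    increase beyond it. *)
Lemma monotone_bound (x y : 'rV[R]_n) (c r : R) : 0 < r -> r <= `|y - x| ->
  (forall u s, `|u| = 1 -> 0 <= s <= r -> c <= (u *m P (x + s *: u) *m u^T) 0 0) ->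
  c * r <= n%:R * `|Phi x - Phi y|.
Proof.
move=> r0 ryx H.
have yx0 : 0 < `|y - x| by exact: lt_le_trans ryx.
pose t := `|y - x|; pose u := t^-1 *: (y - x).
have t0 : 0 < t by [].
have ti : `|t^-1| = t^-1 by apply: gtr0_norm; rewrite invr_gt0.
have u1 : `|u| = 1 by rewrite normrZ ti mulVf // lt0r_neq0.
have yE : y = x + t *: u by rewrite /u scalerA divff ?lt0r_neq0 // scale1r addrC subrK.
have h1 := psi_decr (ltW r0) (fun s => H u s u1).
have h2 : 0 * (t - r) <= psi x u r - psi x u t.
  apply: psi_decr => // s _; apply/ltW/pP; rewrite -normr_eq0 u1; exact: oner_neq0.
rewrite mul0r in h2.
have h3 : c * r <= psi x u 0 - psi x u t.
  by apply: le_trans (_ : psi x u 0 - psi x u r <= _); [rewrite subr0 in h1|lra].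
apply: le_trans h3 _; rewrite /psi scale0r addr0 -yE.
rewrite [X in X - _]mxE [X in _ - X]mxE -sumrB.
apply: (@le_trans _ _ (\sum_(i < n) `|Phi x - Phi y|)); last first.
  by rewrite sumr_const card_ord [leRHS]mulr_natl.
apply: ler_sum => i _; rewrite -mulrBl; apply: le_trans (ler_norm _) _.
rewrite normrM -[leRHS]mulr1; apply: ler_pM => //.
  have := entry_le_norm (Phi x - Phi y) i; rewrite [X in `|X| <= _ -> _]mxE.
  by rewrite [X in `|_ + X| <= _ -> _]mxE.
by rewrite mxE -u1; exact: entry_le_norm.
Qed.

(** A strictly monotone map cannot take nearly equal values at distant points,
    provided that its derivative is bounded below near the first of them. *)
Lemma bounded_preimage (S : set 'rV[R]_n) (A0 : 'M[R]_n) (c eta r : R) :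
  0 < c -> 0 < r ->
  (forall A : 'M[R]_n, (forall i j, `|A0 i j - A i j| < eta) ->
    forall u : 'rV[R]_n, `|u| = 1 -> c <= (u *m A *m u^T) 0 0) ->
  (forall x w, S x -> `|w| <= r -> forall i j, `|A0 i j - P (x + w) i j| < eta) ->
  (forall x y, S x -> S y -> n%:R * `|Phi x - Phi y| < c * r) ->
  exists K, forall x, S x -> `|x| < K.
Proof.
move=> c0 r0 Hc HP HPhi.
have [[x0 Sx0]|nS] := pselect (exists x, S x); last first.
  by exists 0 => x Sx; case: nS; exists x.
exists (r + `|x0|) => x Sx.
have : `|x - x0| < r.
  rewrite ltNge; apply/negP => rx.
  have := HPhi _ _ Sx0 Sx; rewrite ltNge => /negP; apply.
  apply: monotone_bound => // u s u1 /andP[s0 sr]; apply: Hc => //.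
  by apply: HP => //; rewrite normrZ u1 mulr1 ger0_norm.
rewrite -[x in X in _ -> X](subrK x0) => H.
exact: le_lt_trans (ler_normD _ _) (ltr_leD H (lexx _)).
Qed.

End Properness.

(** * The complex exponential *)

Section ComplexExponential.
Local Open Scope complex_scope.
Context {R : realType}.

Lemma cexpD (a a' b b' : R) : cexp (a + a') (b + b') = cexp a b * cexp a' b'.
Proof.
rewrite /cexp expRD cosD sinD; apply/eqP; rewrite eq_complex /=; apply/andP.
by split; apply/eqP; ring.
Qed.

Lemma cexp0 : cexp 0 0 = 1 :> R[i].
Proof. by rewrite /cexp expR0 cos0 sin0 mulr1 mulr0. Qed.

Lemma cexp_neq0 (a b : R) : cexp a b != 0.
Proof.
apply/eqP => E; have := cexpD a (- a) b (- b).
by rewrite E mul0r !subrr cexp0 => /eqP; rewrite oner_eq0.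
Qed.

Lemma norm_cexp0 (b : R) : `|cexp 0 b| = 1 :> R[i].
Proof. by rewrite /cexp normc_def expR0 !mul1r /= cos2Dsin2 sqrtr1. Qed.

Lemma cexp0_eq1 (b : R) : (cexp 0 b = 1) <-> (cos b = 1 /\ sin b = 0).
Proof.
rewrite /cexp expR0 !mul1r; split=> [[-> ->]|[-> ->]] //.
Qed.

Lemma cexp_2pi_nat (k : nat) : cexp 0 (2 * pi * k%:R) = 1 :> R[i].
Proof.
elim: k => [|k IH]; first by rewrite mulr0 cexp0.
have -> : 2 * pi * k.+1%:R = 2 * pi * k%:R + 2 * pi :> R.
  by rewrite -[k.+1]addn1 natrD mulrDr mulr1.
have := cexpD 0 0 (2 * pi * k%:R) (2 * pi); rewrite addr0 IH mul1r => ->.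
by apply/cexp0_eq1; rewrite mulr_natl cos2pi sin2pi.
Qed.

Lemma cexp_2pi (k : int) : cexp 0 (2 * pi * k%:~R) = 1 :> R[i].
Proof.
case: k => k; first exact: cexp_2pi_nat.
have := cexpD 0 0 (2 * pi * k.+1%:R) (2 * pi * (Negz k)%:~R).
by rewrite cexp_2pi_nat mul1r NegzE mulrNz mulrN subrr addr0 cexp0 => <-.
Qed.

Lemma cos_eq1 (r : R) : 0 <= r < 2 * pi -> cos r = 1 -> r = 0.
Proof.
move=> /andP[r0 r2] cr; have p0 := pi_gt0 R.
have H (x : R) : 0 <= x <= pi -> cos x = 1 -> x = 0.
  move=> xI; rewrite -[X in _ = X](cos0 R) => /cos_inj; apply.
    by rewrite in_itv.
  by rewrite in_itv /= lexx ltW.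
have [rp|pr] := leP r pi; first by apply: H => //; rewrite r0.
have : 2 * pi - r = 0.
  apply: H; first by apply/andP; split; lra.
  by rewrite cosB mulr_natl cos2pi sin2pi mul1r mul0r addr0.
lra.
Qed.

Lemma cexp0_eq1P (b : R) : cexp 0 b = 1 <-> exists k : int, b = 2 * pi * k%:~R.
Proof.
split=> [|[k ->]]; last exact: cexp_2pi.
move=> b1; have p0 := pi_gt0 R; have p2 : 0 < 2 * pi :> R by rewrite mulr_gt0.
pose k := Num.floor (b / (2 * pi)); exists k.
have : cexp 0 (b - 2 * pi * k%:~R) = 1.
  have := cexpD 0 0 (b - 2 * pi * k%:~R) (2 * pi * k%:~R).
  by rewrite subrK addr0 b1 cexp_2pi mulr1 => <-.
move=> /cexp0_eq1[c1 _]; apply/eqP; rewrite -subr_eq0; apply/eqP.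
apply: cos_eq1 c1.
rewrite subr_ge0 ltrBlDl mulrC -ler_pdivlMr // ge_floor /=.
rewrite -[X in _ + X]mul1r -mulrDl -ltr_pdivrMr // -[1]/(1%:~R) -intrD.
exact: lt_succ_floor.
Qed.

Lemma cexp_small_eq1 (b : R) : `|b| < 2 * pi -> cexp 0 b = 1 -> b = 0.
Proof.
move=> bp /cexp0_eq1[c1 _]; apply/eqP; rewrite -normr_eq0; apply/eqP.
by apply: cos_eq1; rewrite ?cos_norm // normr_ge0.
Qed.

Variable n : nat.
Implicit Types v w : 'rV[R]_(n + n).

Definition cvec v : 'I_n -> R[i] := fun j => cexp (v 0 (lshift n j)) (v 0 (rshift n j)).

(** The exponential of C^n onto its torus, in real coordinates. *)
Definition expmap v : 'rV[R]_(n + n) :=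
  row_mx (\row_j (expR (v 0 (lshift n j)) * cos (v 0 (rshift n j))))
         (\row_j (expR (v 0 (lshift n j)) * sin (v 0 (rshift n j)))).

Lemma cplx_expmap v : cplx (expmap v) = cvec v.
Proof. by apply/funext => j; rewrite /cplx /expmap row_mxEl row_mxEr !mxE. Qed.

Lemma cvec_torus v : in_torus (cvec v). Proof. by move=> j; exact: cexp_neq0. Qed.

Lemma cvecD v w : cvec (v + w) = (fun j => cvec v j * cvec w j).
Proof. by apply/funext => j; rewrite /cvec !mxE cexpD. Qed.

Lemma cvec0 : cvec 0 = (fun=> 1).
Proof. by apply/funext => j; rewrite /cvec !mxE cexp0. Qed.

Lemma expmap_coordl v j :
  expmap v 0 (lshift n j) = expR (v 0 (lshift n j)) * cos (v 0 (rshift n j)).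
Proof. by rewrite row_mxEl mxE. Qed.

Lemma expmap_coordr v j :
  expmap v 0 (rshift n j) = expR (v 0 (lshift n j)) * sin (v 0 (rshift n j)).
Proof. by rewrite row_mxEr mxE. Qed.

Let oT := @openT 'rV[R]_(n + n).

Lemma Ck_expmap k : Ck k setT expmap.
Proof.
have Ce j : Ck k setT (fun v : 'rV[R]_(n + n) => expR (v 0 j)).
  exact: (Ck_comp_R oT _ (Ck_coord k j oT) (Ck_expR k)).
have Cc j : Ck k setT (fun v : 'rV[R]_(n + n) => cos (v 0 j)).
  exact: (Ck_comp_R oT _ (Ck_coord k j oT) (Ck_sincos k).2).
have Cs j : Ck k setT (fun v : 'rV[R]_(n + n) => sin (v 0 j)).
  exact: (Ck_comp_R oT _ (Ck_coord k j oT) (Ck_sincos k).1).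
apply: Ck_rV => // j; case: (split_ordP j) => i ->.
  by apply: (Ck_eq oT _ (CkM oT (Ce _) (Cc _))) => v _; rewrite expmap_coordl.
by apply: (Ck_eq oT _ (CkM oT (Ce _) (Cs _))) => v _; rewrite expmap_coordr.
Qed.

Lemma differentiable_expmap v : differentiable expmap v.
Proof. exact: Ck_diff (Ck_expmap 0) _. Qed.

Lemma derive_coord m (z w : 'rV[R]_m) j : 'D_w (fun u : 'rV[R]_m => u 0 j) z = w 0 j.
Proof. by rewrite (derive_rowE (f := id)) // derive_id. Qed.

Lemma derive_mul_comp (V : normedModType R) (a b : V -> R) (h k : R -> R) (h' k' : R)
    (z w' : V) :
  differentiable a z -> differentiable b z ->
  is_derive (a z) 1 h h' -> is_derive (b z) 1 k k' ->
  'D_w' (fun y => h (a y) * k (b y)) z =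
  h (a z) * (k' * 'D_w' b z) + k (b z) * (h' * 'D_w' a z).
Proof.
move=> da db dh dk.
have dha : differentiable (fun y => h (a y)) z.
  apply: (@differentiable_comp _ _ _ _ a h) => //.
  by apply/derivable1_diffP; case: dh.
have dkb : differentiable (fun y => k (b y)) z.
  apply: (@differentiable_comp _ _ _ _ b k) => //.
  by apply/derivable1_diffP; case: dk.
have := deriveM (diff_derivable (v := w') dha) (diff_derivable (v := w') dkb).
by rewrite (derive_comp_R w' db dk) (derive_comp_R w' da dh).
Qed.

Lemma mulJ_coordl v j : mulJ v 0 (lshift n j) = - v 0 (rshift n j).
Proof.
rewrite /mulJ /Jcx -[v in v *m _]hsubmxK mul_row_block !mulmx0 add0r addr0.
by rewrite mulmx1 mulmxN mulmx1 row_mxEl !mxE.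
Qed.

Lemma mulJ_coordr v j : mulJ v 0 (rshift n j) = v 0 (lshift n j).
Proof.
rewrite /mulJ /Jcx -[v in v *m _]hsubmxK mul_row_block !mulmx0 add0r addr0.
by rewrite mulmx1 mulmxN mulmx1 row_mxEr !mxE.
Qed.

Lemma derive_expmapl v w j : 'D_w expmap v 0 (lshift n j) =
  expR (v 0 (lshift n j)) * (cos (v 0 (rshift n j)) * w 0 (lshift n j)
    - sin (v 0 (rshift n j)) * w 0 (rshift n j)).
Proof.
rewrite -derive_rowE; last exact: differentiable_expmap.
have -> : (fun y => expmap y 0 (lshift n j)) =
    (fun v : 'rV[R]_(n + n) => expR (v 0 (lshift n j)) * cos (v 0 (rshift n j))).
  by apply/funext => y; exact: expmap_coordl.
have dc l : differentiable (fun u : 'rV[R]_(n + n) => u 0 l) v.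
  exact: differentiable_coord.
rewrite (derive_mul_comp w (dc _) (dc _) (is_derive_expR _) (is_derive_cos _)).
rewrite !derive_coord; ring.
Qed.

Lemma derive_expmapr v w j : 'D_w expmap v 0 (rshift n j) =
  expR (v 0 (lshift n j)) * (sin (v 0 (rshift n j)) * w 0 (lshift n j)
    + cos (v 0 (rshift n j)) * w 0 (rshift n j)).
Proof.
rewrite -derive_rowE; last exact: differentiable_expmap.
have -> : (fun y => expmap y 0 (rshift n j)) =
    (fun v : 'rV[R]_(n + n) => expR (v 0 (lshift n j)) * sin (v 0 (rshift n j))).
  by apply/funext => y; exact: expmap_coordr.
have dc l : differentiable (fun u : 'rV[R]_(n + n) => u 0 l) v.
  exact: differentiable_coord.
rewrite (derive_mul_comp w (dc _) (dc _) (is_derive_expR _) (is_derive_sin _)).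
rewrite !derive_coord; ring.
Qed.

(** The Cauchy-Riemann equations of the exponential. *)
Lemma derive_expmap_mulJ v w : 'D_(mulJ w) expmap v = mulJ ('D_w expmap v).
Proof.
apply/rowP => l; case: (split_ordP l) => j ->.
  rewrite [RHS]mulJ_coordl; apply: etrans (derive_expmapl v (mulJ w) j) _.
  apply: etrans _ (esym (congr1 -%R (derive_expmapr v w j))).
  rewrite mulJ_coordl mulJ_coordr; ring.
rewrite [RHS]mulJ_coordr; apply: etrans (derive_expmapr v (mulJ w) j) _.
apply: etrans _ (esym (derive_expmapl v w j)).
rewrite mulJ_coordl mulJ_coordr; ring.
Qed.

End ComplexExponential.

(** * The action in charts *)

Lemma within_continuous_comp (X Y Z : topologicalType) (S : set Y) (g : Y -> Z)
    (h : X -> Y) (x : X) : {within S, continuous g} -> (forall x, S (h x)) ->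
  {for x, continuous h} -> {for x, continuous (fun x => g (h x))}.
Proof.
move=> cg Sh ch U /= Ug.
have := cg (h x) U Ug; rewrite /= /nbhs /= -nbhs_subspace_in; last exact: Sh.
rewrite /within /= => H.
have := ch _ H; rewrite /nbhs /=; apply: filterS => y /=; apply; exact: Sh.
Qed.

Section Slices.
Context {R : realType} {V W X : normedModType R}.
Implicit Types (H : V * W -> X).

Lemma derive_slice H t z v :
  'D_v (fun t => H (t, z)) t = 'D_((v, 0) : V * W) H (t, z).
Proof.
rewrite /derive; congr (lim (_ @ 0^')).
apply/funext => h /=.
have E : h *: ((v, 0) : V * W) + (t, z) = (h *: v + t, z).
  by apply: (congr1 (pair _)); rewrite /= scaler0 add0r.
by rewrite E.
Qed.

Lemma differentiable_slice H t z : differentiable H (t, z) ->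
  differentiable (fun t => H (t, z)) t.
Proof.
by move=> dH; apply: (@differentiable_comp _ _ _ _ (fun t => (t, z)) H).
Qed.

(** Iterated derivatives of the slice are iterated derivatives of H in the
    directions (v, 0). *)
Lemma smooth_slice H (B : set (V * W)) z : smooth_on B H ->
  smooth_on [set t | B (t, z)] (fun t => H (t, z)).
Proof.
move=> Hs s t Bt.
have -> : foldr (fun (v : V) (h : V -> X) a => 'D_v h a) (fun t => H (t, z)) s =
    (fun t => foldr (fun (v : V * W) (h : V * W -> X) a => 'D_v h a) H
      [seq (v, 0) | v <- s] (t, z)).
  elim: s => [//|v s IH] /=; rewrite IH; apply/funext => a.
  exact: derive_slice.
by apply: differentiable_slice; exact: Hs.
Qed.

Lemma differentiable_slice2 H t z : differentiable H (t, z) ->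
  differentiable (fun z => H (t, z)) z.
Proof.
by move=> dH; apply: (@differentiable_comp _ _ _ _ (fun z => (t, z)) H).
Qed.

End Slices.

Lemma derive_comp (R : realType) (U V W : normedModType R) (f : U -> V) (g : V -> W)
    (h : U -> W) z w : (forall y, h y = g (f y)) ->
  differentiable f z -> differentiable g (f z) ->
  'D_w h z = 'D_('D_w f z) g (f z).
Proof.
move=> /funext -> df dg.
have -> : (fun y => g (f y)) = g \o f by [].
have dgf := differentiable_comp df dg.
by rewrite (deriveE _ dgf) (deriveE _ dg) (deriveE _ df) (diff_comp df dg).
Qed.

Section Charts.
Local Open Scope complex_scope.
Context {R : realType} {n : nat} {M : topologicalType} {X : complexManifold R n M}.
Variables (A : toricAction X).
Implicit Types (q : M) (v w : 'rV[R]_(n + n)) (i j : chart_index X).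

Lemma log_paramD q v w : log_param A q (v + w) = log_param A (log_param A q v) w.
Proof.
rewrite /log_param -[LHS]/(tact A (cvec (v + w)) q) addrC cvecD tactM //;
  exact: cvec_torus.
Qed.

Lemma log_param0 q : log_param A q 0 = q.
Proof. by rewrite -[LHS]/(tact A (cvec 0) q) cvec0 tact1. Qed.

Lemma log_paramE q v : log_param A q v = tact A (cplx (expmap v)) q.
Proof. by rewrite cplx_expmap. Qed.

Lemma continuous_log_param v q :
  {for (v, q), continuous (fun vq : 'rV[R]_(n + n) * M => log_param A vq.2 vq.1)}.
Proof.
rewrite (_ : (fun vq => _) = (fun vq : 'rV[R]_(n + n) * M =>
    (fun tp : 'rV[R]_(n + n) * M => tact A (cplx tp.1) tp.2) (expmap vq.1, vq.2))).
  apply: (@within_continuous_comp ('rV[R]_(n + n) * M)%type ('rV[R]_(n + n) * M)%type M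
     [set tp | in_torus (cplx tp.1)]
     (fun tp : 'rV[R]_(n + n) * M => tact A (cplx tp.1) tp.2)
     (fun vq : 'rV[R]_(n + n) * M => (expmap vq.1, vq.2))).
  - exact: tact_continuous.
  - by move=> vq /=; rewrite cplx_expmap; exact: cvec_torus.
  - have cE : expmap vq.1 @[vq --> nbhs ((v, q) : 'rV[R]_(n + n) * M)] --> nbhs (expmap v).
      apply: (@cvg_comp _ _ _ fst (@expmap R n) _ (nbhs v)); first exact: cvg_fst.
      exact: differentiable_continuous (differentiable_expmap v).
    have cS : vq.2 @[vq --> nbhs ((v, q) : 'rV[R]_(n + n) * M)] --> nbhs q.
      exact: cvg_snd.
    exact: (cvg_pair cE cS).
by apply/funext => vq; exact: log_paramE.
Qed.

Lemma continuous_log_param_v q : continuous (log_param A q).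
Proof.
move=> v.
have c1 : y @[y --> nbhs (v : 'rV[R]_(n + n))] --> nbhs v by exact: cvg_id.
have c2 : q @[_ --> nbhs (v : 'rV[R]_(n + n))] --> nbhs q by exact: cvg_cst.
exact: (cvg_comp _ _ (cvg_pair c1 c2) (@continuous_log_param v q)).
Qed.

Definition chart_region q i : set 'rV[R]_(n + n) :=
  [set v | chart_dom i (log_param A q v)].

Lemma open_chart_region q i : open (chart_region q i).
Proof.
apply: open_comp; last exact: chart_dom_open.
by move=> v _; exact: continuous_log_param_v.
Qed.

Lemma chart_img_map i q : chart_dom i q -> chart_img i (chart_map i q).
Proof. by exists q. Qed.

Lemma chart_img_inv i z : chart_img i z -> chart_dom i (chart_inv i z).
Proof. by move=> [p ip <-]; rewrite chart_mapK. Qed.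

Lemma chart_invK i z : chart_img i z -> chart_map i (chart_inv i z) = z.
Proof. by move=> [p ip <-]; rewrite chart_mapK. Qed.

Definition log_chart q i v : 'rV[R]_(n + n) := chart_map i (log_param A q v).

(** The action read in charts; the point of the torus comes first. *)
Definition act_chart i j (tz : 'rV[R]_(n + n) * 'rV[R]_(n + n)) : 'rV[R]_(n + n) :=
  chart_map j (tact A (cplx tz.1) (chart_inv i tz.2)).

Definition act_region i j : set ('rV[R]_(n + n) * 'rV[R]_(n + n)) :=
  [set tz | [/\ in_torus (cplx tz.1), chart_img i tz.2
           & chart_dom j (tact A (cplx tz.1) (chart_inv i tz.2))]].

Lemma act_chart_expmap i j q v : chart_dom i q ->
  log_chart q j v = act_chart i j (expmap v, chart_map i q).
Proof. by move=> iq; rewrite /act_chart /= chart_mapK // -log_paramE. Qed.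

Lemma act_region_expmap i j q v : chart_dom i q -> chart_region q j v ->
  act_region i j (expmap v, chart_map i q).
Proof.
move=> iq jv; split=> /=; first by rewrite cplx_expmap; exact: cvec_torus.
  exact: chart_img_map.
by rewrite chart_mapK // -log_paramE.
Qed.

Lemma Ck_log_chart k q i : Ck k (chart_region q i) (log_chart q i).
Proof.
have [j jq] : exists j, chart_dom j q by exists (chart_at X q); exact: chart_atP.
have oU : open (chart_region q i) by exact: open_chart_region.
have hs := (tact_holomorphic A j i).1.
have Hk := (smooth_onP _ _).1 (smooth_slice (z := chart_map j q) hs) k.
have Ek : Ck k (chart_region q i) (@expmap R n) by apply: Ck_sub (Ck_expmap n k).
have EB v : chart_region q i v -> act_region j i (expmap v, chart_map j q).
  exact: act_region_expmap.
apply: (Ck_eq oU _ (Ck_comp_rV oU EB Ek Hk)) => v _.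
by rewrite (act_chart_expmap _ _ jq).
Qed.

Lemma differentiable_log_chart q i v : chart_region q i v ->
  differentiable (log_chart q i) v.
Proof. by move=> iv; exact: Ck_diff (Ck_log_chart 0 q i) iv. Qed.

Lemma derive_log_chart j q i v w : chart_dom j q -> chart_region q i v ->
  'D_w (log_chart q i) v =
  'D_('D_w (@expmap R n) v, 0) (act_chart j i) (expmap v, chart_map j q).
Proof.
move=> jq iv.
have dH : differentiable (act_chart j i) (expmap v, chart_map j q).
  apply: ((tact_holomorphic A j i).1 [::]); exact: act_region_expmap.
have dE := differentiable_expmap v.
have dS := differentiable_slice dH.
rewrite -derive_slice; apply: (derive_comp _ _ dE dS) => y.
exact: act_chart_expmap.
Qed.

(** Both the exponential and the action are holomorphic. *)
Lemma derive_log_chart_mulJ q i v w : chart_region q i v ->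
  'D_(mulJ w) (log_chart q i) v = mulJ ('D_w (log_chart q i) v).
Proof.
move=> iv; have jq := chart_atP X q; set j := chart_at X q in jq.
apply: etrans (derive_log_chart _ jq iv) _.
apply: etrans _ (esym (congr1 (@mulJ R n) (derive_log_chart w jq iv))).
have rg := act_region_expmap jq iv.
have dH : differentiable (act_chart j i) (expmap v, chart_map j q).
  exact: ((tact_holomorphic A j i).1 [::]).
have := (tact_holomorphic A j i).2 _ rg ('D_w (@expmap R n) v, 0).
rewrite derive_expmap_mulJ !(deriveE _ dH) /mulJ2 /=.
by rewrite {2}/mulJ mul0mx.
Qed.

Definition jac q i v : 'M[R]_(n + n) := jacobian (log_chart q i) v.

Lemma derive_jac q i v w : chart_region q i v -> 'D_w (log_chart q i) v = w *m jac q i v.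
Proof. by move=> iv; apply: deriveEjacobian; exact: differentiable_log_chart. Qed.

Lemma jac_J q i v : chart_region q i v -> Jcx R n *m jac q i v = jac q i v *m Jcx R n.
Proof.
move=> iv; apply/row_matrixP => l; rewrite !rowE !mulmxA.
have := derive_log_chart_mulJ (delta_mx 0 l) iv.
by rewrite !derive_jac.
Qed.

Lemma log_param_real_torus q v (xi : 'rV[R]_n) (s : R) :
  tact A (fun l => cexp 0 (s * xi 0 l)) (log_param A q v) =
  log_param A q (v + s *: row_mx 0 xi).
Proof.
rewrite log_paramD -[RHS]/(tact A (cvec _) _); congr (tact A _ _).
by apply/funext => l; rewrite /cvec scale_row_mx scaler0 row_mxEl row_mxEr !mxE.
Qed.

(** The real torus acts on the logarithmic parameter by translation in the
    imaginary direction. *)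
Lemma fundamental_jac q i v xi : chart_region q i v ->
  fundamental_field A xi i (log_chart q i v) = xi *m dsubmx (jac q i v).
Proof.
move=> iv; rewrite /fundamental_field /log_chart chart_mapK //.
under eq_fun => s do rewrite log_param_real_torus.
have dv : differentiable (log_chart q i) (v + 0 *: row_mx 0 xi).
  by rewrite scale0r addr0; exact: differentiable_log_chart.
have [_ ->] := is_derive_line dv.
rewrite scale0r addr0 derive_jac // -[jac q i v in LHS]vsubmxK mul_row_col.
by rewrite mul0mx add0r.
Qed.

End Charts.

(** * Fundamental fields and the moment map *)

Lemma Ck_local (R : realType) (V W : normedModType R) k (U : set V) (f : V -> W) :
  (forall z, U z -> exists2 B : set V, B z & Ck k B f) -> Ck k U f.
Proof.
elim: k f => [|k IH] f H; split=> //.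
- by move=> z /H [B Bz CB]; exact: Ck_diff CB Bz.
- by move=> z /H [B Bz CB]; exact: Ck_diff CB Bz.
move=> v; apply: IH => z /H [B Bz CB]; exists B => //; exact: Ck_derive CB.
Qed.

Lemma mx_entryE (R : realType) n (N : 'M[R]_n) a b :
  (basis_vec R a *m N *m (basis_vec R b)^T) 0 0 = N a b.
Proof. by rewrite /basis_vec -rowE trmx_delta -colE !mxE. Qed.

Section Gram.
Local Open Scope complex_scope.
Context {R : realType} {n : nat} {M : topologicalType} {X : complexManifold R n M}.
Variables (A : toricAction X) (g : kahlerMetric X) (mu : M -> 'rV[R]_n).
Hypothesis hmu : moment_map A g mu.
Implicit Types (q : M) (v w : 'rV[R]_(n + n)) (i : chart_index X).
Local Notation J := (Jcx R n).

(** The rows are the fundamental fields of the basis of the Lie algebra. *)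
Definition orbit_field i (z : 'rV[R]_(n + n)) : 'M[R]_(n, n + n) :=
  \matrix_(l, k) fundamental_field A (basis_vec R l) i z 0 k.

(** The inner products of the fundamental fields. They are defined at every
    point of M, also where the fields are linearly dependent. *)
Definition gram i (z : 'rV[R]_(n + n)) : 'M[R]_n :=
  orbit_field i z *m metric g i z *m (orbit_field i z)^T.

Lemma orbit_field_jac q i v : chart_region A q i v ->
  orbit_field i (log_chart A q i v) = dsubmx (jac A q i v).
Proof.
move=> iv; apply/matrixP => l k; rewrite mxE fundamental_jac //.
by rewrite -rowE mxE.
Qed.

(** The real directions are - i times the imaginary ones. *)
Lemma usubmx_jac q i v : chart_region A q i v ->
  usubmx (jac A q i v) = - (dsubmx (jac A q i v) *m J).
Proof.
move=> iv; have := jac_J iv.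
rewrite -[jac A q i v in LHS]vsubmxK -[jac A q i v in RHS]vsubmxK.
rewrite /Jcx mul_block_col mul_col_mx => /eq_col_mx[_].
by rewrite mul0mx addr0 mulNmx mul1mx => <-; rewrite opprK.
Qed.

Lemma chart_region_img q i v : chart_region A q i v -> chart_img i (log_chart A q i v).
Proof. by move=> iv; exact: chart_img_map. Qed.

(** The moment map identity transported to the logarithmic parameter. *)
Lemma momentum_derive q i v w (xi : 'rV[R]_n) : chart_region A q i v ->
  'D_w (fun y => (mu (log_param A q y) *m xi^T) 0 0) v =
  (xi *m dsubmx (jac A q i v) *m kahler_form g i (log_chart A q i v) *m
    (w *m jac A q i v)^T) 0 0.
Proof.
move=> iv; have [hs _ hd] := hmu.
pose G a := (mu (chart_inv i a) *m xi^T) 0 0.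
transitivity ('D_w (fun y => G (log_chart A q i y)) v).
  apply: near_eq_derive.
  have : nbhs v (chart_region A q i).
    by apply: open_nbhs_nbhs; split=> //; exact: open_chart_region.
  by apply: filterS => y iy; rewrite /G /log_chart chart_mapK.
have iz := chart_region_img iv.
have dG : differentiable G (log_chart A q i v).
  have -> : G = (fun a => \sum_l (fun a => mu (chart_inv i a) 0 l * xi 0 l) a).
    by apply/funext => a; rewrite /G mxE; apply: eq_bigr => l _; rewrite mxE.
  apply: differentiable_bigsum => l.
  have dl : differentiable (fun a => mu (chart_inv i a) 0 l) (log_chart A q i v).
    apply: (@differentiable_comp _ _ _ _ (fun a => mu (chart_inv i a))
      (fun y : 'rV[R]_n => y 0 l)); last exact: differentiable_coord.
    exact: (hs i [::]).
  exact: (differentiableM dl (differentiable_cst (xi 0 l) _)).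
have hE y : G (log_chart A q i y) = G (log_chart A q i y) by [].
rewrite (derive_comp w hE (differentiable_log_chart iv) dG).
by rewrite /G hd // fundamental_jac // derive_jac.
Qed.

Lemma momentum_invariant q v (xi : 'rV[R]_n) :
  mu (log_param A q (v + row_mx 0 xi)) = mu (log_param A q v).
Proof.
have [_ hi _] := hmu.
rewrite -[row_mx _ _]scale1r -log_param_real_torus hi // => l.
exact: norm_cexp0.
Qed.

(** The moment map is constant along the orbits of the real torus, so its
    derivatives in the directions tangent to them vanish. *)
Lemma orbit_isotropic q i v : chart_region A q i v ->
  dsubmx (jac A q i v) *m kahler_form g i (log_chart A q i v) *m
    (dsubmx (jac A q i v))^T = 0.
Proof.
move=> iv; set Y := dsubmx _; set B := kahler_form _ _ _.
apply/matrixP => a b; rewrite [RHS]mxE.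
have := momentum_derive (row_mx 0 (basis_vec R b)) (basis_vec R a) iv.
have -> : 'D_(row_mx 0 (basis_vec R b))
    (fun y => (mu (log_param A q y) *m (basis_vec R a)^T) 0 0) v = 0.
  apply: etrans (derive_cst ((mu (log_param A q v) *m (basis_vec R a)^T) 0 0) v
    (row_mx 0 (basis_vec R b))).
  rewrite /derive; congr (lim (_ @ 0^')); apply/funext => h /=.
  have E : mu (log_param A q (h *: row_mx 0 (basis_vec R b) + v)) =
      mu (log_param A q v).
    by rewrite (addrC _ v) scale_row_mx scaler0 momentum_invariant.
  by rewrite E.
rewrite -[jac A q i v in X in _ = X -> _]vsubmxK mul_row_col mul0mx add0r -/Y -/B.
by rewrite col_mxKd trmx_mul -(mx_entryE (Y *m B *m Y^T)) !mulmxA => <-.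
Qed.

(** The diagonal blocks agree because the metric is Hermitian, and the
    others vanish because the orbits are isotropic. *)
Lemma pullback_log q i v : chart_region A q i v ->
  jac A q i v *m metric g i (log_chart A q i v) *m (jac A q i v)^T =
  block_mx (gram i (log_chart A q i v)) 0 0 (gram i (log_chart A q i v)).
Proof.
move=> iv; rewrite /gram orbit_field_jac //.
have iz := chart_region_img iv.
have := orbit_isotropic iv; rewrite /kahler_form /form_of.
have := usubmx_jac iv; have hs := Defs.metric_sym g iz.
have hh := metric_hermitian g iz.
rewrite -{5 6}[jac A q i v]vsubmxK.
move: (metric g _ _) (dsubmx _) (usubmx _) hs hh => G Y U hs hh -> iso.
have h12 : - (Y *m J) *m G *m Y^T = 0.
  by rewrite !mulNmx -(mulmxA Y) iso oppr0.
rewrite mul_col_mx tr_col_mx mul_col_row; congr block_mx.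
- by rewrite linearN /= trmx_mul mulmxN !mulNmx opprK -!mulmxA; congr (_ *m _); rewrite !mulmxA hh.
- exact: h12.
- by move: (congr1 trmx h12); rewrite trmx_mul trmxK trmx_mul hs mulmxA trmx0.
Qed.

(** The gradient of the moment map in the real directions recovers the
    metric. *)
Lemma momentum_derive_gram q i v (w xi : 'rV[R]_n) : chart_region A q i v ->
  'D_(row_mx w 0) (fun y => (mu (log_param A q y) *m xi^T) 0 0) v =
  - (xi *m gram i (log_chart A q i v) *m w^T) 0 0.
Proof.
move=> iv; rewrite (momentum_derive _ _ iv).
have iz := chart_region_img iv.
rewrite /gram orbit_field_jac // /kahler_form /form_of.
have -> : row_mx w 0 *m jac A q i v = w *m usubmx (jac A q i v).
  by rewrite -{1}[jac A q i v]vsubmxK mul_row_col mul0mx addr0.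
rewrite usubmx_jac //.
have hh := metric_hermitian g iz.
move: (metric g _ _) (dsubmx _) hh => G Y hh.
rewrite mulmxN linearN /= mulmxN mxE; congr (- _ 0 0).
by rewrite !trmx_mul !mulmxA -[in RHS]hh !mulmxA.
Qed.

Lemma Ck_momentum k q : Ck k setT (fun v => mu (log_param A q v)).
Proof.
have [hs _ _] := hmu.
apply: Ck_local => v _; pose i := chart_at X (log_param A q v).
exists (chart_region A q i); first exact: chart_atP.
have oU : open (chart_region A q i) by exact: open_chart_region.
have HB u : chart_region A q i u -> chart_img i (log_chart A q i u).
  exact: chart_region_img.
apply: (Ck_eq oU _ (Ck_comp_rV oU HB (Ck_log_chart A k q i) ((smooth_onP _ _).1 (hs i) k))).
by move=> u iu; rewrite /log_chart chart_mapK.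
Qed.

End Gram.

(** * The metric on the open orbit *)

(** Two difference quotients that agree for all h have the same limit; this
    compares derivatives of functions on different spaces. *)
Lemma derive_shift_eq (R : realType) (V V' W : normedModType R) (f : V -> W) (f' : V' -> W)
    (z w : V) (z' w' : V') : (forall h : R, f (h *: w + z) = f' (h *: w' + z')) ->
  'D_w f z = 'D_w' f' z'.
Proof.
move=> H; rewrite /derive; congr (lim (_ @ 0^')); apply/funext => h /=.
have := H 0; rewrite !scale0r !add0r => ->.
by rewrite /shift /= H.
Qed.

Section OpenOrbit.
Local Open Scope complex_scope.
Context {R : realType} {n : nat} {M : topologicalType} {X : complexManifold R n M}.
Variables (A : toricAction X) (g : kahlerMetric X) (mu : M -> 'rV[R]_n).
Hypothesis hmu : moment_map A g mu.
Variable p0 : M.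
Hypothesis hp0 : in_open_orbit A p0.
Implicit Types (q : M) (v w : 'rV[R]_(n + n)) (i j : chart_index X) (x y u : 'rV[R]_n).
Local Notation F := (log_param A p0).

Lemma continuous_tact t : in_torus t -> continuous (tact A t).
Proof.
move=> tt q.
pose tau : 'rV[R]_(n + n) := row_mx (\row_l complex.Re (t l)) (\row_l complex.Im (t l)).
have tE : cplx tau = t.
  apply/funext => l; rewrite /cplx /tau row_mxEl row_mxEr !mxE.
  by case: (t l).
have c1 : tau @[_ --> nbhs q] --> nbhs tau by exact: cvg_cst.
have c2 : y @[y --> nbhs q] --> nbhs q by exact: cvg_id.
rewrite -tE.
apply: (@within_continuous_comp M ('rV[R]_(n + n) * M)%type M
     [set tp | in_torus (cplx tp.1)]
     (fun tp : 'rV[R]_(n + n) * M => tact A (cplx tp.1) tp.2)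
     (fun q : M => (tau, q))).
- exact: tact_continuous.
- by move=> _ /=; rewrite tE.
- exact: (cvg_pair c1 c2).
Qed.

(** The torus is commutative, so the stabilizer of p0 fixes its orbit
    pointwise. The orbit is dense and M is Hausdorff, so the stabilizer fixes
    all of M, and the action is effective. *)
Lemma stabilizer_trivial t : in_torus t -> tact A t p0 = p0 -> t = (fun=> 1).
Proof.
move=> tt tp; apply: (@tact_effective R n M X A t tt) => q.
have [_ dO] := hp0.
apply/eqP/negPn/negP => /eqP tq.
have := cm_hausdorff X; rewrite open_hausdorff => /(_ _ _ (introN eqP tq)).
move=> [[B C] /= [Btq Cq] [oB oC BC0]]; rewrite !inE in Btq Cq.
have oO : open ((tact A t @^-1` B) `&` C).
  apply: openI => //; apply: open_comp => // y _; exact: continuous_tact.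
have [|y [[By Cy] [s st sy]]] := dO _ _ oO; first by exists q.
have ty : tact A t y = y.
  rewrite -sy -[in RHS]tp -!tactM //; congr (tact A _ _).
  by apply/funext => l; rewrite mulrC.
by have : (B `&` C) y; [split=> //; rewrite -ty|rewrite (eqP BC0)].
Qed.

Lemma log_param_inj v q q' : log_param A q v = log_param A q' v -> q = q'.
Proof.
by move=> E; rewrite -(log_param0 A q) -(log_param0 A q') -(subrr v) !log_paramD E.
Qed.

Lemma log_param_eq v w : F v = F (v + w) <-> cvec w = (fun=> 1).
Proof.
rewrite addrC log_paramD; split=> [E|E].
  apply: stabilizer_trivial; first exact: cvec_torus.
  exact/esym/(log_param_inj E).
by rewrite -[F w]/(tact A (cvec w) p0) E tact1.
Qed.

Lemma cvec_eq1 u : cvec (row_mx 0 u) = (fun=> 1) <-> forall l, cexp 0 (u 0 l) = 1.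
Proof.
split=> [E l|E].
  by have := congr1 (@^~ l) E; rewrite /cvec row_mxEl row_mxEr mxE.
by apply/funext => l; rewrite /cvec row_mxEl row_mxEr mxE.
Qed.

Definition momentum x : 'rV[R]_n := mu (F (row_mx x 0)).

(** Minus the Jacobian matrix of the moment map in the variable x. Defining it
    this way makes its smoothness and symmetries those of the moment map. *)
Definition gram_field x : 'M[R]_n :=
  \matrix_(l, k) - pderiv k (fun y => momentum y 0 l) x.

Lemma momentumE x y : mu (F (row_mx x y)) = momentum x.
Proof.
rewrite /momentum -(momentum_invariant hmu p0 (row_mx x 0) y).
by rewrite add_row_mx addr0 add0r.
Qed.

Lemma entry_dot (u : 'rV[R]_n) l : (u *m (basis_vec R l)^T) 0 0 = u 0 l.
Proof. by rewrite /basis_vec trmx_delta -colE mxE. Qed.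

(** The right-hand side does not involve y, since the moment map does not. *)
Lemma gram_fieldE i x y : chart_region A p0 i (row_mx x y) ->
  gram A g i (log_chart A p0 i (row_mx x y)) = gram_field x.
Proof.
move=> iv; apply/matrixP => a b; rewrite [RHS]mxE.
have := momentum_derive_gram hmu (basis_vec R b) (basis_vec R a) iv.
rewrite mx_entryE => E; apply: oppr_inj; rewrite -E opprK.
apply: derive_shift_eq => h.
by rewrite entry_dot scale_row_mx scaler0 add_row_mx add0r momentumE.
Qed.

Lemma region_at v : chart_region A p0 (chart_at X (F v)) v.
Proof. exact: chart_atP. Qed.

Lemma Ck_row_mx0 k : Ck k setT (fun x : 'rV[R]_n => row_mx x 0 : 'rV[R]_(n + n)).
Proof.
have oT := @openT 'rV[R]_n; apply: Ck_rV => // l; case: (split_ordP l) => l' ->.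
  by apply: (Ck_eq oT _ (Ck_coord k l' oT)) => z _; rewrite row_mxEl.
by apply: (Ck_eq oT _ (Ck_cst k setT (0 : R))) => z _; rewrite row_mxEr mxE.
Qed.

Lemma Ck_momentum_orbit k : Ck k setT momentum.
Proof.
exact: (Ck_comp_rV (B := setT) (@openT _) (fun _ _ => Logic.I) (Ck_row_mx0 k)
  (Ck_momentum hmu k p0)).
Qed.

Lemma smooth_momentum l : smooth_on setT (fun x => momentum x 0 l).
Proof.
apply/smooth_onP => k.
exact: (Ck_comp_rV (B := setT) (@openT _) (fun _ _ => Logic.I) (Ck_momentum_orbit k)
  (Ck_coord k l (@openT _))).
Qed.

Lemma differentiable_momentum x : differentiable momentum x.
Proof. exact: Ck_diff (Ck_momentum_orbit 0) _. Qed.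

Lemma momentum_derive_gram_field x (w : 'rV[R]_n) u :
  ('D_w momentum x *m u^T) 0 0 = - (u *m gram_field x *m w^T) 0 0.
Proof.
rewrite mxE [X in - X]mxE -sumrN.
have E l : 'D_w momentum x 0 l = - \sum_k gram_field x l k * w 0 k.
  rewrite -derive_rowE; last exact: differentiable_momentum.
  rewrite derive_sum_pderiv; last exact: smooth_differentiable (smooth_momentum l) x.
  by rewrite -sumrN; apply: eq_bigr => k _; rewrite mxE mulNr opprK mulrC.
under eq_bigr => l _ do rewrite E mulNr mulr_suml -sumrN.
rewrite exchange_big; apply: eq_bigr => k _ /=.
rewrite [w^T k 0]mxE [(u *m _) _ _]mxE mulr_suml -sumrN; apply: eq_bigr => l _.
rewrite [u^T l 0]mxE; ring.
Qed.

Lemma gram_psd i z u : chart_img i z -> 0 <= (u *m gram A g i z *m u^T) 0 0.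
Proof.
move=> iz; rewrite /gram !mulmxA -mulmxA -trmx_mul.
have [->|u0] := eqVneq (u *m orbit_field A i z) 0; first by rewrite !mul0mx mxE.
by apply: ltW; exact: (metric_posdef g iz).
Qed.

Lemma gram_ker i z u : chart_img i z -> (u *m gram A g i z *m u^T) 0 0 = 0 ->
  u *m orbit_field A i z = 0.
Proof.
move=> iz; rewrite /gram !mulmxA -mulmxA -trmx_mul => E.
apply/eqP/negPn/negP => u0.
by have := metric_posdef g iz u0; rewrite E ltxx.
Qed.

(** The inner products of the fundamental fields do not depend on the
    imaginary part. If the field of u vanishes somewhere on an orbit of the
    real torus it therefore vanishes on all of it, and its flow is
    stationary. *)
Lemma orbit_const x u i (d : R) : (u *m gram_field x *m u^T) 0 0 = 0 ->
  (forall s, 0 <= s <= d -> chart_region A p0 i (row_mx x (s *: u))) ->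
  0 < d -> F (row_mx x (d *: u)) = F (row_mx x 0).
Proof.
move=> uPu H d0.
have vE s : row_mx x (s *: u) = row_mx x 0 + s *: row_mx 0 u.
  by rewrite scale_row_mx scaler0 add_row_mx addr0 add0r.
have D0 s : 0 <= s <= d -> 'D_(row_mx 0 u) (log_chart A p0 i) (row_mx x (s *: u)) = 0.
  move=> /H iv; rewrite derive_jac // -[jac _ _ _ _]vsubmxK mul_row_col mul0mx add0r.
  rewrite -(orbit_field_jac iv); apply: gram_ker; first exact: chart_region_img.
  by rewrite gram_fieldE.
have dl s l : 0 <= s <= d -> is_derive s 1
    (fun s => log_chart A p0 i (row_mx x 0 + s *: row_mx 0 u) 0 l) 0.
  move=> sI; have iv := H _ sI.
  have df : differentiable (fun v => log_chart A p0 i v 0 l) (row_mx x 0 + s *: row_mx 0 u).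
    rewrite -vE; apply: (@differentiable_comp _ _ _ _ (log_chart A p0 i)
      (fun y : 'rV[R]_(n + n) => y 0 l)); last exact: differentiable_coord.
    exact: differentiable_log_chart.
  have := is_derive_line df; rewrite derive_rowE; last first.
    by rewrite -vE; exact: differentiable_log_chart.
  by rewrite -vE D0 // mxE.
have E : log_chart A p0 i (row_mx x (d *: u)) = log_chart A p0 i (row_mx x 0).
  apply/rowP => l.
  have [||s sI] := @MVT _ (fun s => log_chart A p0 i (row_mx x 0 + s *: row_mx 0 u) 0 l)
    (fun=> 0) 0 d d0.
  - by move=> s; rewrite in_itv /= => /andP[/ltW s0 /ltW sd]; apply: dl; rewrite s0.
  - apply: derivable_within_continuous => s; rewrite in_itv /= => sI.
    by have [] := dl _ l sI.
  by rewrite mul0r -!vE scale0r => /eqP; rewrite subr_eq0 => /eqP.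
have := congr1 (chart_inv i) E.
rewrite /log_chart !chart_mapK //; first by have := H 0; rewrite scale0r lexx ltW //; apply.
by apply: H; rewrite lexx ltW.
Qed.

(** Otherwise a fundamental field vanishes on the orbit over x, and small
    elements exp (e u) of the torus, different from 1, fix p0. *)
Lemma gram_field_posdef x : posdef (gram_field x).
Proof.
move=> u u0.
pose i := chart_at X (F (row_mx x 0)).
have ix : chart_region A p0 i (row_mx x 0) by exact: region_at.
have ge0 : 0 <= (u *m gram_field x *m u^T) 0 0.
  by rewrite -(gram_fieldE ix); apply: gram_psd; exact: chart_region_img.
rewrite lt_def ge0 andbT; apply/negP => /eqP uPu.
have [d d0 Hd] : exists2 d : R, 0 < d &
    forall s, 0 <= s <= d -> chart_region A p0 i (row_mx x (s *: u)).
  have nb : nbhs (row_mx x 0 : 'rV[R]_(n + n)) (chart_region A p0 i).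
    by apply: open_nbhs_nbhs; split=> //; exact: open_chart_region.
  have [e /= e0 He] := (nbhs_ballP _ _).1 nb.
  pose w : 'rV[R]_(n + n) := row_mx 0 u.
  have W0 : 0 < `|w| + 1 by rewrite ltr_wpDl.
  exists (e / (`|w| + 1)); first by rewrite divr_gt0.
  move=> s /andP[s0 sd]; apply: He; rewrite -ball_normE /=.
  have -> : row_mx x 0 - row_mx x (s *: u) = - s *: w.
    by rewrite opp_row_mx add_row_mx subrr sub0r -scaleNr /w scale_row_mx scaler0.
  rewrite normrZ normrN ger0_norm //.
  apply: le_lt_trans (ler_wpM2r (normr_ge0 _) sd) _.
  by rewrite mulrAC ltr_pdivrMr // ltr_pM2l // ltrDl.
(* With e <= pi/(|u| + 1) the angles e u_j are smaller than 2 pi, so that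
   exp (e u) = 1 forces u = 0. *)
pose e := Num.min d (pi / (`|u| + 1)).
have U0 : 0 < `|u| + 1 by rewrite ltr_wpDl.
have e0 : 0 < e by rewrite /e lt_min d0 divr_gt0 // pi_gt0.
have E : F (row_mx x (e *: u)) = F (row_mx x 0).
  apply: (orbit_const (i := i)) => // s /andP[s0 se]; apply: Hd.
  by rewrite s0 (le_trans se) // /e ge_min lexx.
have := (log_param_eq (row_mx x 0) (row_mx 0 (e *: u))).1.
rewrite add_row_mx addr0 add0r => /(_ (esym E)) /cvec_eq1 H.
move: u0; apply/negP; rewrite negbK; apply/eqP/rowP => l; rewrite [RHS]mxE.
have : (e *: u) 0 l = 0.
  apply: cexp_small_eq1 (H l); apply: le_lt_trans (entry_le_norm _ _) _.
  rewrite normrZ gtr0_norm //.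
  apply: (@le_lt_trans _ _ (pi / (`|u| + 1) * `|u|)).
    by rewrite ler_wpM2r // /e ge_min lexx orbT.
  rewrite mulrAC ltr_pdivrMr // -[2 * pi]mulrC -mulrA ltr_pM2l ?pi_gt0 //.
  have := normr_ge0 u; lra.
by rewrite mxE => /eqP; rewrite mulf_eq0 gt_eqF //= => /eqP.
Qed.

Lemma gram_field_hessian_metric : hessian_metric gram_field.
Proof.
split.
- move=> a b; have := smooth_onN (smooth_pderiv b (smooth_momentum a)).
  by apply: smooth_eq; [exact: openT|move=> z _; rewrite mxE].
- move=> x a b; have ix := region_at (row_mx x 0).
  rewrite -(gram_fieldE ix); set G := gram _ _ _ _.
  have Gs : G^T = G.
    by rewrite /G /gram !trmx_mul trmxK (Defs.metric_sym g (chart_region_img ix)) mulmxA.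
  by rewrite -{1}Gs mxE.
- exact: gram_field_posdef.
- move=> x a b c.
  have E k l : pderiv k (fun y => gram_field y a l) x =
      - pderiv k (pderiv l (fun y => momentum y 0 a)) x.
    rewrite -pderivN; last first.
      exact: smooth_differentiable (smooth_pderiv l (smooth_momentum a)) x.
    by apply: eq_pderiv => y; rewrite mxE.
  apply: etrans (E c b) _; apply: etrans _ (esym (E b c)); apply: (congr1 -%R).
  exact: hessian_sym (smooth_momentum a).
Qed.

End OpenOrbit.

(** * Decay of the volume on a compact manifold *)

Section Decay.
Local Open Scope complex_scope.
Context {R : realType} {n : nat} {M : topologicalType} {X : complexManifold R n M}.
Variables (A : toricAction X) (g : kahlerMetric X) (mu : M -> 'rV[R]_n).
Hypothesis hmu : moment_map A g mu.
Variable p0 : M.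
Hypothesis hp0 : in_open_orbit A p0.
Implicit Types (p q : M) (v w : 'rV[R]_(n + n)) (i j : chart_index X) (x y u : 'rV[R]_n).
Local Notation F := (log_param A p0).
Local Notation P := (gram_field A mu p0).

(** This makes the dependence on z explicit, so that the fundamental fields
    are seen to be smooth on M, not only along the open orbit. *)
Lemma fundamental_act_chart i z (xi : 'rV[R]_n) : chart_img i z ->
  fundamental_field A xi i z =
  'D_('D_(row_mx 0 xi) (@expmap R n) 0, 0) (act_chart A i i) (expmap 0, z).
Proof.
move=> iz; have iq := chart_img_inv iz.
have i0 : chart_region A (chart_inv i z) i 0 by rewrite /chart_region /= log_param0.
have zE : log_chart A (chart_inv i z) i 0 = z by rewrite /log_chart log_param0 chart_invK.
have := fundamental_jac xi i0; rewrite zE => ->.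
have := derive_log_chart (row_mx 0 xi) iq i0; rewrite chart_invK // => <-.
by rewrite derive_jac // -[jac _ _ _ _ in RHS]vsubmxK mul_row_col mul0mx add0r.
Qed.

Lemma differentiable_orbit_field i z a b : chart_img i z ->
  differentiable (fun z => orbit_field A i z a b) z.
Proof.
move=> iz; pose w := 'D_(row_mx 0 (basis_vec R a)) (@expmap R n) 0.
have rg : act_region A i i (expmap 0, z).
  split=> //=; first by rewrite cplx_expmap; exact: cvec_torus.
  by rewrite cplx_expmap cvec0 tact1; exact: chart_img_inv.
have d1 : differentiable (fun tz => 'D_((w, 0)) (act_chart A i i) tz) (expmap 0, z).
  exact: ((tact_holomorphic A i i).1 [:: (w, 0)]).
have d2 := differentiable_slice2 d1.
have d3 : differentiable (fun z => 'D_((w, 0)) (act_chart A i i) (expmap 0, z) 0 b) z.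
  exact: (@differentiable_comp _ _ _ _
    (fun z => 'D_((w, 0)) (act_chart A i i) (expmap 0, z))
    (fun y : 'rV[R]_(n + n) => y 0 b) _ d2 (differentiable_coord _ _ _)).
apply: near_eq_differentiable d3.
have : nbhs z (chart_img i) by apply: open_nbhs_nbhs; split=> //; exact: chart_img_open.
by apply: filterS => y iy; rewrite mxE fundamental_act_chart.
Qed.

Lemma differentiable_gram i z a b : chart_img i z ->
  differentiable (fun z => gram A g i z a b) z.
Proof.
move=> iz.
have dG l k : differentiable (fun z => metric g i z l k) z.
  apply: (@differentiable_comp _ _ _ _ (metric g i) (fun N : 'M[R]_(n + n) => N l k)).
    exact: (metric_smooth g (i := i) [::]).
  exact: differentiable_coord.
have -> : (fun z => gram A g i z a b) = (fun z => \sum_k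
    (fun z => (\sum_l (fun z => orbit_field A i z a l * metric g i z l k) z)
      * orbit_field A i z b k) z).
  apply/funext => y; rewrite /gram mxE; apply: eq_bigr => k _.
  by rewrite [_^T _ _]mxE [(_ *m _) _ _]mxE.
apply: differentiable_bigsum => k.
apply: (differentiableM (f := fun z => \sum_l orbit_field A i z a l * metric g i z l k)
  (g := fun z => orbit_field A i z b k)); last exact: differentiable_orbit_field.
apply: differentiable_bigsum => l.
exact: (differentiableM (differentiable_orbit_field a l iz) (dG l k)).
Qed.

Lemma chart_gram p i x : chart_dom i (F (row_mx x 0)) ->
  gram A g i (chart_map i (F (row_mx x 0))) = P x.
Proof. by move=> ix; exact: gram_fieldE. Qed.

Lemma log_param_translate x (w : 'rV[R]_n) : log_param A (F (row_mx x 0)) (row_mx w 0) =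
  F (row_mx (x + w) 0).
Proof. by rewrite -log_paramD add_row_mx addr0. Qed.

Lemma near_orbit_map p (U : set M) : nbhs p U ->
  exists2 BC : set 'rV[R]_n * set M, nbhs (0 : 'rV[R]_n) BC.1 /\ nbhs p BC.2 &
    forall (w : 'rV[R]_n) q, BC.1 w -> BC.2 q -> U (log_param A q (row_mx w 0)).
Proof.
move=> nU.
have nU' : nbhs (log_param A p 0) U by rewrite log_param0.
have [[B C] /= [nB nC] BC] := @continuous_log_param _ _ _ _ A 0 p U nU'.
have c0 : {for 0, continuous (fun x : 'rV[R]_n => row_mx x 0 : 'rV[R]_(n + n))}.
  apply: differentiable_continuous; exact: Ck_diff (Ck_row_mx0 0) _.
have nB' : nbhs (row_mx (0 : 'rV[R]_n) (0 : 'rV[R]_n)) B by rewrite row_mx0.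
exists ((fun w : 'rV[R]_n => row_mx w 0) @^-1` B, C) => /=.
  by split=> //; exact: (c0 B nB').
by move=> w q Bw Cq; apply: (BC (row_mx w 0, q)).
Qed.

Lemma continuous_mu p : {for p, continuous mu}.
Proof.
have [hs _ _] := hmu; pose i := chart_at X p; have ip : chart_dom i p := chart_atP X p.
have c1 : {for p, continuous (fun q => mu (chart_inv i (chart_map i q)))}.
  apply: (@cvg_comp _ _ _ (chart_map i) (fun z => mu (chart_inv i z)) _
    (nbhs (chart_map i p))); first exact: chart_map_continuous.
  have dm : differentiable (fun z => mu (chart_inv i z)) (chart_map i p).
    by apply: (hs i [::]); exact: chart_img_map.
  exact: differentiable_continuous dm.
have E : mu (chart_inv i (chart_map i p)) = mu p by rewrite chart_mapK.
rewrite /prop_for /continuous_at E in c1.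
apply: cvg_trans c1; apply: near_eq_cvg.
have : nbhs p (chart_dom i) by apply: open_nbhs_nbhs; split=> //; exact: chart_dom_open.
by apply: filterS => q iq; rewrite chart_mapK.
Qed.

Variables (c : R) (vol : 'rV[R]_n -> R).
Hypothesis (volE : forall x, vol x = c * Num.sqrt (\det (P x))).
Hypothesis n0 : (0 < n)%N.

(** Near p the volume is close to a multiple of the square root of the Gram
    determinant at p. If that determinant is 0, the volume is small near p.
    Otherwise the Gram matrices of all points near p, moved a little in the real
    directions, are bounded below. The moment map varies little near p, so by
    [bounded_preimage] only a bounded set of x has its orbit near p. *)
Lemma local_decay p (e : R) : 0 < e -> exists2 N, nbhs p N &
  exists K : R, forall x, K <= `|x| -> N (F (row_mx x 0)) -> vol x < e.
Proof.
move=> e0; pose i := chart_at X p; have ip : chart_dom i p := chart_atP X p.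
pose z := chart_map i p; have iz : chart_img i z by exact: chart_img_map.
have nd : nbhs p (chart_dom i) by apply: open_nbhs_nbhs; split=> //; exact: chart_dom_open.
have dgram : mxdifferentiable (gram A g i) z.
  by move=> a b; exact: differentiable_gram.
have [d0|d0] := eqVneq (\det (gram A g i z)) 0.
  (* delta is vol on the open orbit and continuous near z also off it. *)
  pose delta (y : 'rV[R]_(n + n)) := c * Num.sqrt (\det (gram A g i y)).
  have cd : {for p, continuous (fun q => delta (chart_map i q))}.
    apply: (@cvg_comp _ _ _ (chart_map i) delta _ (nbhs z)).
      exact: chart_map_continuous.
    apply: cvgM; first exact: cvg_cst.
    apply: (@cvg_comp _ _ _ (fun y : 'rV[R]_(n + n) => \det (gram A g i y)) Num.sqrt _
      (nbhs (\det (gram A g i z)))).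
      exact: differentiable_continuous (differentiable_det dgram).
    exact: sqrt_continuous.
  have dz : delta z < e by rewrite /delta d0 sqrtr0 mulr0.
  have nN : nbhs p [set q | delta (chart_map i q) < e].
    have ne : nbhs (delta z) [set y | y < e].
      by apply: open_nbhs_nbhs; split=> //; exact: open_lt.
    exact: (cd _ ne).
  exists ([set q | delta (chart_map i q) < e] `&` chart_dom i); first exact: filterI.
  exists 0 => x _ [xe ix]; rewrite volE; move: xe.
  by rewrite /delta /= chart_gram.
have pz : posdef (gram A g i z).
  move=> u u0; rewrite lt_def gram_psd // andbT; apply: contraNneq d0 => E.
  have uO := gram_ker iz E; apply/det0P; exists u => //.
  by rewrite /gram !mulmxA uO !mul0mx.
have [k [eta [k0 eta0 Hk]]] := posdef_uniform n0 pz.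
pose good (q : M) := chart_dom i q /\
  forall a b, `|gram A g i z a b - gram A g i (chart_map i q) a b| < eta.
have ngood : nbhs p good.
  apply: filterI => //.
  have H a b : nbhs p [set q | `|gram A g i z a b - gram A g i (chart_map i q) a b| < eta].
    have cg : gram A g i (chart_map i q) a b @[q --> p] --> gram A g i z a b.
      apply: (@cvg_comp _ _ _ (chart_map i) (fun y : 'rV[R]_(n + n) => gram A g i y a b) _ (nbhs z)).
        exact: chart_map_continuous.
      exact: differentiable_continuous (dgram a b).
    by move/cvgrPdist_lt : cg => /(_ _ eta0).
  by apply: filter_forall => a; apply: filter_forall => b; exact: H.
have [[B C] /= [nB nC] BC] := near_orbit_map ngood.
(* r is such that [good] holds along the translates of the points of C by real
   vectors of length at most r. *)
have [r r0 Hr] : exists2 r : R, 0 < r & forall w : 'rV[R]_n, `|w| <= r -> B w.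
  have [e1 /= e10 He1] := (nbhs_ballP _ _).1 nB.
  exists (e1 / 2); first by rewrite divr_gt0.
  move=> w we; apply: He1; rewrite -ball_normE /= sub0r normrN.
  by apply: le_lt_trans we _; rewrite ltr_pdivrMr // ltr_pMr // ltr1n.
have n0R : 0 < n%:R :> R by rewrite ltr0n.
(* Two values of the moment map within kr of mu p differ by less than k r / n,
   the separation required by [bounded_preimage]. *)
pose kr := k * r / (2 * n%:R).
have kr0 : 0 < kr by rewrite !mulr_gt0 // invr_gt0 mulr_gt0.
have nmu : nbhs p [set q | `|mu p - mu q| < kr].
  by have := continuous_mu (p := p) => /cvgrPdist_lt/(_ _ kr0).
pose N := C `&` [set q | `|mu p - mu q| < kr].
exists N; first exact: filterI.
pose S : set 'rV[R]_n := [set x | N (F (row_mx x 0))].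
have dPhi := differentiable_momentum hmu p0.
have [K HK] : exists K, forall x, S x -> `|x| < K.
  apply: (@bounded_preimage R n (momentum A mu p0) P dPhi _ _ S (gram A g i z) k eta r) => //.
  - by move=> x w v; exact: (momentum_derive_gram_field hmu p0 x w v).
  - exact: (gram_field_posdef hmu hp0).
  - move=> x w [Cx _] wr a b.
    have [ix Hx] := BC w (F (row_mx x 0)) (Hr w wr) Cx.
    rewrite /= log_param_translate in ix Hx.
    by rewrite -(chart_gram p ix).
  - move=> x y [_ Nx] [_ Ny].
    have : `|momentum A mu p0 x - momentum A mu p0 y| < kr + kr.
      rewrite -(subrK (mu p) (momentum A mu p0 x)) -addrA.
      apply: le_lt_trans (ler_normD _ _) (ltrD _ _); last exact: Ny.
      by rewrite distrC; exact: Nx.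
    rewrite -(ltr_pM2l n0R) => /lt_le_trans; apply.
    have nn : n%:R != 0 :> R by exact: lt0r_neq0.
    rewrite le_eqVlt; apply/orP; left; apply/eqP; rewrite /kr; field.
    exact: nn.
by exists K => x Kx Nx; have := HK x Nx; rewrite ltNge Kx.
Qed.

(** Compactness of M turns the local statements into a uniform one. *)
Lemma vol_decay (e : R) : compact [set: M] -> 0 < e ->
  exists K : R, forall x, K <= `|x| -> vol x < e.
Proof.
move=> /compact_near_coveringP cM e0.
have := cM R (pinfty_nbhs R) (fun K q => forall x, K <= `|x| -> F (row_mx x 0) = q -> vol x < e).
case=> [p _|K [_ HK]].
  have [N nN [K HK]] := local_decay p e0.
  exists (N, [set K' | K <= K']) => /=.
    split=> //; exists K; split; [exact: num_real|by move=> K' /ltW].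
  move=> [q K'] /= [Nq KK'] x K'x Fx.
  by apply: HK; [exact: le_trans K'x|rewrite Fx].
exists (K + 1) => x Kx; apply: (HK (K + 1)) Kx erefl => //.
by rewrite ltrDl.
Qed.

End Decay.

(** * Volume and extrinsic geometry of the torus orbits *)

Lemma cube_integral_cst (R : realType) k (c : R) (f : 'rV[R]_k -> R) :
  (forall y, f y = c) -> cube_integral f = (2 * pi) ^+ k * c.
Proof.
elim: k f => [|k IH] f fc /=; first by rewrite fc expr0 mul1r.
rewrite (_ : (fun t : R => cube_integral _) = (fun=> (2 * pi) ^+ k * c)); last first.
  by apply/funext => t; apply: IH => y; exact: fc.
have p0 : (0 : R) < 2 * pi by rewrite mulr_gt0 // pi_gt0.
rewrite Rintegral_cst; last exact: measurable_itv.
have -> : fine (lebesgue_measure [set` `[(0 : R), 2 * pi]]) = 2 * pi.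
  by rewrite lebesgue_measure_itv /= lte_fin p0 /= subr0.
by rewrite exprS mulrC mulrA.
Qed.

Section TorusOrbits.
Local Open Scope complex_scope.
Context {R : realType} {n : nat} {M : topologicalType} {X : complexManifold R n M}.
Variables (A : toricAction X) (g : kahlerMetric X) (mu : M -> 'rV[R]_n).
Hypothesis hmu : moment_map A g mu.
Variable p0 : M.
Hypothesis hp0 : in_open_orbit A p0.
Implicit Types (x y u : 'rV[R]_n).
Local Notation F := (log_param A p0).
Local Notation P := (gram_field A mu p0).

Lemma log_metricE : log_metric A g p0 = tube_metric P.
Proof.
apply/funext => v; have iv := region_at A p0 v.
rewrite /log_metric /pullback -[LHS]/(jac A p0 _ v *m metric g _ (log_chart A p0 _ v) *m
  (jac A p0 _ v)^T).
rewrite (pullback_log hmu iv) /tube_metric.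
have vE : row_mx (lsubmx v) (rsubmx v) = v by exact: hsubmxK.
have := gram_fieldE hmu (g := g) (x := lsubmx v) (y := rsubmx v).
by rewrite vE => /(_ p0 _ iv) ->.
Qed.

Lemma jacobian_orbit i x y : chart_region A p0 i (row_mx x y) ->
  jacobian (fun a => chart_map i (orbit_param A p0 x a)) y =
  dsubmx (jac A p0 i (row_mx x y)).
Proof.
move=> iv; have df := differentiable_log_chart iv.
have ds := @differentiable_tube_orbit R n x y.
have dc : differentiable (fun a => chart_map i (orbit_param A p0 x a)) y.
  exact: (@differentiable_comp _ _ _ _ (fun a => row_mx x a) (log_chart A p0 i) _ ds df).
apply/row_matrixP => a; rewrite rowE -(deriveEjacobian _ dc).
rewrite (derive_comp (f := fun a => row_mx x a) (g := log_chart A p0 i) _ _ ds df) //.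
rewrite (deriveEjacobian _ ds) jacobian_tube_orbit mul_mx_row mulmx0 mulmx1.
rewrite derive_jac // -[jac _ _ _ _]vsubmxK mul_row_col mul0mx add0r col_mxKd.
by rewrite -rowE.
Qed.

Lemma pullback_orbit x y : pullback (metric g) (orbit_param A p0 x) y = P x.
Proof.
have iv := region_at A p0 (row_mx x y).
rewrite /pullback jacobian_orbit // -(gram_fieldE hmu iv) /gram orbit_field_jac //.
Qed.

Lemma lagrangian_orbit x : is_lagrangian_param g (orbit_param A p0 x).
Proof.
move=> y; have iv := region_at A p0 (row_mx x y).
by rewrite /pullback jacobian_orbit //; exact: (orbit_isotropic hmu iv).
Qed.

Lemma VolE x : Vol A g p0 x = (2 * pi) ^+ n * Num.sqrt (\det (P x)).
Proof.
by apply: cube_integral_cst => y; rewrite pullback_orbit.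
Qed.

Lemma torus_param_orbit x : is_torus_param X (orbit_param A p0 x).
Proof.
split=> [y y'|y].
  have E : row_mx x y' = row_mx x y + row_mx 0 (y' - y).
    by rewrite add_row_mx addr0 addrC subrK.
  rewrite /orbit_param E (log_param_eq hp0) cvec_eq1; split=> [H|[k Hk] l].
    have /choice[k Hk] l : exists k : int, (y' - y) 0 l = 2 * pi * k%:~R.
      exact: (cexp0_eq1P _).1 (H l).
    by exists k; apply/rowP => l; rewrite [RHS]mxE.
  by apply/cexp0_eq1P; exists (k l); rewrite Hk mxE.
have iv := region_at A p0 (row_mx x y).
rewrite jacobian_orbit // -kermx_eq0; apply/rowV0P => u /sub_kermxP uX.
apply/eqP/negPn/negP => u0.
have := gram_field_posdef hmu hp0 x u0.
by rewrite -(gram_fieldE hmu iv) /gram orbit_field_jac // !mulmxA uX !mul0mx mxE ltxx.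
Qed.

Lemma minimal_orbit x : critical_point (half_log_det P) x -> is_minimal_orbit A g p0 x.
Proof.
move=> cx y; rewrite log_metricE.
exact: (mean_curvature_tube (gram_field_hessian_metric hmu hp0)).
Qed.

End TorusOrbits.

(** * Ricci curvature and convexity of the volume *)

Theorem mainTheorem1 (R : realType) (n : nat) (hn : (0 < n)%N)
    (M : topologicalType) (X : complexManifold R n M) (A : toricAction X)
    (g : kahlerMetric X) (hham : hamiltonian A g)
    (p0 : M) (hp0 : in_open_orbit A p0) :
  ((ricci_neg_on_orbit A g p0 <->
      strictly_convex (fun x => ln (Vol A g p0 x))) /\
   (ricci_neg_on_orbit A g p0 ->
      strictly_convex (Vol A g p0) /\ ~ compact [set: M])) /\
  ((ricci_pos_on_orbit A g p0 <->
      strictly_convex (fun x => - ln (Vol A g p0 x))) /\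
   (ricci_pos_on_orbit A g p0 ->
      strictly_convex (fun x => (Vol A g p0 x)^-1) /\
      (compact [set: M] ->
         exists x0 : 'rV[R]_n,
           [/\ critical_point (Vol A g p0) x0,
               forall x, critical_point (Vol A g p0) x -> x = x0,
               forall x, Vol A g p0 x <= Vol A g p0 x0
             & [/\ is_torus_param X (orbit_param A p0 x0),
                   is_lagrangian_param g (orbit_param A p0 x0)
                 & is_minimal_orbit A g p0 x0]]))).
Proof.
have [mu hmu] := hham.
have hP := gram_field_hessian_metric hmu hp0; set P := gram_field A mu p0 in hP.
have c0 : 0 < (2 * pi) ^+ n :> R by rewrite exprn_gt0 // mulr_gt0 // pi_gt0.
have volE := VolE hmu p0; rewrite -/P in volE.
have decay := vol_decay hmu hp0 volE hn.
have lnV := strictly_convex_ln_Vol hP c0 volE.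
have NlnV := strictly_convex_Nln_Vol hP c0 volE.
have neg : ricci_neg_on_orbit A g p0 <-> strictly_convex (half_log_det P).
  by rewrite /ricci_neg_on_orbit (log_metricE hmu p0); exact: ricci_neg_tube.
have pos : ricci_pos_on_orbit A g p0 <-> strictly_convex (fun x => - half_log_det P x).
  by rewrite /ricci_pos_on_orbit (log_metricE hmu p0); exact: ricci_pos_tube.
split; split.
- exact: iff_trans neg (iff_sym lnV).
- move=> /neg cf; split; first exact: (strictly_convex_Vol hP c0 volE).
  move=> cM; apply: (Vol_not_convex hP c0 volE (fun e => decay e cM) hn).
  exact: (strictly_convex_Vol hP c0 volE).
- exact: iff_trans pos (iff_sym NlnV).
- move=> /pos cf; split; first exact: (strictly_convex_invVol hP c0 volE).
  move=> cM; have [x0 [cx0 ux0 mx0 cfx0]] :=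
    Vol_unique_max hP c0 volE (fun e => decay e cM) cf.
  exists x0; split=> //; split.
  + exact: (torus_param_orbit hmu hp0).
  + exact: (lagrangian_orbit hmu).
  + exact: (minimal_orbit hmu hp0).
Qed.
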